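(* Let $q$ be an odd prime power and $\Gamma=Sp_4(\mathbb F_q[T])=\{A\in M_{4\times4}(\mathbb F_q[T]):A^tJA=J\}$ (with $J$ the $4\times4$ matrix with $J_{14}=J_{23}=1$, $J_{32}=J_{41}=-1$, other entries $0$); it is a finitely generated group. There exists a length function $\ell:\Gamma\to\mathbb R_{\ge0}$, bi-Lipschitz equivalent to the word length on $\Gamma$, such that: the constant function $1$ on $\Gamma$ is not the pointwise limit of any family $(f_\alpha)_{\alpha\in I}$ of finitely supported $\ell$-radial functions on $\Gamma$ with $\sup_{\alpha}\|m_{f_\alpha}\|_{MC^*_r(\Gamma)}<\infty$; and for every finite $p>4$, it is not the pointwise limit of any family $(f_\alpha)_{\alpha\in I}$ of finitely supported $\ell$-radial functions on $\Gamma$ with $\sup_\alpha\|m_{f_\alpha}\|_{ML^p(L\Gamma)}<\infty$.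
   Context: A length function is $\ell:\Gamma\to\mathbb R_{\ge0}$ with $\ell(\gamma\gamma')\le\ell(\gamma)+\ell(\gamma')$; a function $f$ is $\ell$-radial if $f(\gamma)=f(\gamma')$ whenever $\ell(\gamma)=\ell(\gamma')$. $L(\Gamma)$ is the group von Neumann algebra with trace $\tau(x)=\langle\delta_1,x\delta_1\rangle$, $L^p(L\Gamma)$ the completion of $L(\Gamma)$ under $\tau(|x|^p)^{1/p}$, and for $\varphi\in\mathbb C\Gamma$ (finitely supported) its $C^*_r$-norm is the operator norm of $\lambda(\varphi)$ on $\ell^2\Gamma$. Fourier multiplier norms (not necessarily completely bounded): $\|m_f\|_{ML^p(L\Gamma)}=\sup\{\|f\varphi\|_{L^p(L\Gamma)}:\varphi\in\mathbb C\Gamma,\|\varphi\|_{L^p(L\Gamma)}\le1\}$ (pointwise product), and $\|m_f\|_{MC^*_r(\Gamma)}$ is defined the same way with the $C^*_r(\Gamma)$-norm. *)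

(* Defs.v *)
From HB Require Import structures.
From mathcomp Require Import all_boot all_order all_algebra.
From mathcomp Require Import all_classical all_reals all_analysis.
From mathcomp Require Import complex.

Set Implicit Arguments.
Unset Strict Implicit.
Unset Printing Implicit Defensive.

Import Order.TTheory GRing.Theory Num.Theory.
Import numFieldNormedType.Exports.
Local Open Scope classical_set_scope.
Local Open Scope ring_scope.



Section Sp4.
Variable F : finFieldType.
Local Notation P := {poly F}.

Definition Jmx : 'M[P]_4 :=
  \matrix_(i < 4, j < 4)
    (if ((i == 0 :> nat) && (j == 3 :> nat)) || ((i == 1 :> nat) && (j == 2 :> nat)) then 1
     else if ((i == 2 :> nat) && (j == 1 :> nat)) || ((i == 3 :> nat) && (j == 0 :> nat)) then -1
     else 0).

Definition is_sp4 (A : 'M[P]_4) : bool := A^T *m Jmx *m A == Jmx.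

Definition Sp4 := {A : 'M[P]_4 | is_sp4 A}.

Lemma Jmx_tr : Jmx^T = - Jmx.
Proof.
apply/matrixP => i j; rewrite !mxE.
by case: i => [[|[|[|[|?]]]] ?] //; case: j => [[|[|[|[|?]]]] ?] //=; rewrite ?oppr0 ?opprK.
Qed.

Lemma JmxJmx : Jmx *m Jmx = - 1%:M.
Proof.
apply/matrixP => i j; rewrite !mxE !big_ord_recr big_ord0 /= !mxE.
by case: i => [[|[|[|[|?]]]] ?] //; case: j => [[|[|[|[|?]]]] ?] //=;
  rewrite ?mul0r ?mulr0 ?mul1r ?mulr1 ?add0r ?addr0 ?mulrNN ?oppr0.
Qed.

Lemma sp4_mul (A B : 'M[P]_4) : is_sp4 A -> is_sp4 B -> is_sp4 (A *m B).
Proof.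
rewrite /is_sp4 => /eqP hA /eqP hB; rewrite trmx_mul.
by rewrite -!mulmxA (mulmxA A^T) (mulmxA _ A) hA mulmxA hB.
Qed.

Lemma sp4_1 : is_sp4 1%:M.
Proof. by rewrite /is_sp4 trmx1 mul1mx mulmx1. Qed.

Definition sp_inv (A : 'M[P]_4) : 'M[P]_4 := - (Jmx *m A^T *m Jmx).

Lemma sp_invK_l (A : 'M[P]_4) : is_sp4 A -> sp_inv A *m A = 1%:M.
Proof.
rewrite /is_sp4 /sp_inv => /eqP hA.
by rewrite mulNmx -!mulmxA (mulmxA A^T) hA JmxJmx opprK.
Qed.

Lemma sp_AJAt (A : 'M[P]_4) : is_sp4 A -> A *m Jmx *m A^T = Jmx.
Proof.
move=> hA; have h1 := sp_invK_l hA.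
have h2 : A *m sp_inv A = 1%:M by apply: mulmx1C.
have h3 : A *m Jmx *m A^T *m Jmx = - 1%:M.
  by rewrite -h2 /sp_inv mulmxN opprK !mulmxA.
have : A *m Jmx *m A^T *m (Jmx *m Jmx) = - Jmx.
  by rewrite mulmxA h3 mulNmx mul1mx.
by rewrite JmxJmx mulmxN mulmx1 => /eqP; rewrite eqr_opp => /eqP.
Qed.

Lemma sp4_inv (A : 'M[P]_4) : is_sp4 A -> is_sp4 (sp_inv A).
Proof.
move=> hA; rewrite /is_sp4 /sp_inv.
have hT : (- (Jmx *m A^T *m Jmx))^T = - (Jmx *m A *m Jmx).
  by rewrite linearN /= !trmx_mul trmxK Jmx_tr mulNmx mulmxN opprK mulmxN mulmxA.
rewrite hT !mulNmx mulmxN opprK.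
have -> : Jmx *m A *m Jmx *m Jmx *m (Jmx *m A^T *m Jmx)
          = - (Jmx *m (A *m Jmx *m A^T) *m Jmx).
  by rewrite -(mulmxA _ Jmx Jmx) JmxJmx mulmxN mulmx1 mulNmx !mulmxA.
by rewrite (sp_AJAt hA) JmxJmx mulNmx mul1mx opprK.
Qed.

Definition oneG : Sp4 := exist _ 1%:M sp4_1.
Definition mulG (g h : Sp4) : Sp4 := exist _ (val g *m val h) (sp4_mul (valP g) (valP h)).
Definition invG (g : Sp4) : Sp4 := exist _ (sp_inv (val g)) (sp4_inv (valP g)).

End Sp4.

Section Analysis.
Variables (R : realType) (F : finFieldType).
Local Notation G := (Sp4 F).
Local Notation C := R[i].

Definition cnorm (z : C) : R := Num.sqrt (complex.Re z ^+ 2 + complex.Im z ^+ 2).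

Definition fin_supp (f : G -> C) : Prop := finite_set [set g | f g != 0].

Definition lambda (phi xi : G -> C) : G -> C :=
  fun g => \sum_(h \in [set: G]) phi h * xi (mulG (invG h) g).

(* phi^*(g) = conj(phi(g^-1)), so that lambda(phi)^* = lambda(phi^* ) *)
Definition adjf (phi : G -> C) : G -> C :=
  fun g => complex.conjc (phi (invG g)).

Definition delta1 : G -> C := fun g => if g == oneG F then 1 else 0.

Definition l2norm (xi : G -> C) : R :=
  Num.sqrt (\sum_(g \in [set: G]) (cnorm (xi g)) ^+ 2).

(* reduced C*-norm of phi in C Gamma: operator norm of lambda(phi) on l^2 Gamma
   (finitely supported vectors are dense in l^2 Gamma) *)
Definition cstar_norm (phi : G -> C) : R :=
  sup [set l2norm (lambda phi xi) | xi in [set xi | fin_supp xi /\ l2norm xi <= 1]].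

(* tau((x^* x)^k) = < delta_1, (x^* x)^k delta_1 >  for x = lambda(phi) *)
Definition moment (phi : G -> C) (k : nat) : R :=
  complex.Re (iter k (fun xi => lambda (adjf phi) (lambda phi xi)) delta1 (oneG F)).

Definition tau_poly (phi : G -> C) (Q : {poly R}) : R :=
  \sum_(k < size Q) Q`_k * moment phi k.

(* tau(|x|^p) = tau(h(x^* x)) with h(s) = s^(p/2), computed through the
   continuous functional calculus: h(x^* x) is the norm limit of Q_n(x^* x)
   for any polynomials Q_n -> h uniformly on [0, ||x||^2] (which contains the
   spectrum of x^* x), and tau is norm continuous. *)
Definition tau_abs_pow (p : R) (phi : G -> C) : R :=
  xget 0 [set v : R | forall Q : nat -> {poly R},
     (forall e : R, 0 < e -> exists N : nat, forall n : nat, (N <= n)%N ->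
        forall s : R, 0 <= s <= cstar_norm phi ^+ 2 ->
          `|(Q n).[s] - s `^ (p / 2)| < e) ->
     (fun n => tau_poly phi (Q n)) @ \oo --> v].

Definition lp_norm (p : R) (phi : G -> C) : R := tau_abs_pow p phi `^ p^-1.

(* pointwise product f phi (Fourier multiplier m_f applied to phi) *)
Definition pt_mul (f phi : G -> C) : G -> C := fun g => f g * phi g.

Definition is_word (S : seq G) (w : seq G) (g : G) : Prop :=
  all (fun s => s \in S ++ map (@invG F) S) w /\ g = foldr (@mulG F) (oneG F) w.

Definition generates (S : seq G) : Prop := forall g, exists w, is_word S w g.

Definition length_function (l : G -> R) : Prop :=
  (forall g, 0 <= l g) /\ (forall g h, l (mulG g h) <= l g + l h).

(* l is bi-Lipschitz equivalent to the word length |.|_S: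
   |g|_S <= c l(g) and l(g) <= c |g|_S, |g|_S = min size of a word for g *)
Definition bilipschitz_to_word (l : G -> R) (S : seq G) : Prop :=
  exists c : R, 0 < c /\ forall g,
    (forall w, is_word S w g -> l g <= c * (size w)%:R) /\
    (exists w, is_word S w g /\ (size w)%:R <= c * l g).

Definition radial (l : G -> R) (f : G -> C) : Prop :=
  forall g g', l g = l g' -> f g = f g'.

Definition directed (I : Type) (le : I -> I -> Prop) : Prop :=
  (exists a : I, True) /\ (forall a, le a a) /\
  (forall a b c, le a b -> le b c -> le a c) /\
  (forall a b, exists c, le a c /\ le b c).

Definition net_to_one (I : Type) (le : I -> I -> Prop) (f : I -> G -> C) : Prop :=
  forall g (e : R), 0 < e -> exists a0, forall a, le a0 a ->
    cnorm (f a g - 1) < e.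

End Analysis.

(* Main.v *)
Require Import Defs.
From HB Require Import structures.
From mathcomp Require Import all_boot all_order all_algebra.
From mathcomp Require Import all_classical all_reals all_analysis.
From mathcomp Require Import complex.
From mathcomp Require Import ring lra zify finmap.

(** The length of g <> 1 is the largest size (degree + 1) among the entries and the
2 x 2 minors of g.  On the abelian group of Siegel unipotents [[1, X], [0, 1]], X = [[a, b], [c, a]],
it only depends on the degrees of the entries and of det X = a^2 - b c.  On the coset b = T^n,
with deg a, deg c <= n, write c = floor(a^2 / T^n) + d: the length is n + 1 if d = 0 and n + 2 if
d = T, so a radial function f is constant along the "parabola" d = 0 and along its translate d = T,
with values z_n and z_(n+1).  Let nu be the average over a of the difference of the two point
masses.  In nu^* nu the term of increment u in a averages point masses over a |-> floor(2 u a / T^n)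
and, for deg u >= 1, is killed by the difference in d; hence ||nu||^2 <= 4 q^-n.  On the finite group
H of order q^(2n+2) of the increments (a, c), pairing f nu with the trivial representation gives
|z_n - z_(n+1)| = |sum f nu| <= |H|^(1/p) ||f nu||_p.  After normalising nu to
have norm at most 1 in C^*_r, hence in L^p, this reads |z_n - z_(n+1)| <= C q^(n (2/p - 1/2)), with
2/p replaced by 0 for C^*_r.  Thus a uniform multiplier bound forces |z_n| <= C' r^n with r < 1,
since z_n vanishes for large n, against z_n -> 1 along the net.

The L^p norms are computed by diagonalising x^* x on l^2(H); that the limit defining
tau(|x|^p) is unique follows from Bernstein approximation of s^(p/2).

For the word length: conjugation by A in SL_2(F[T]) with A + A^-1 = T turns Horner's scheme into
words of length O(deg), which produces all root elements cheaply, and Euclid's algorithm on the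
columns reduces g to the identity using quotients of total degree O(deg g). *)

Set Implicit Arguments.
Unset Strict Implicit.
Unset Printing Implicit Defensive.
Import Order.TTheory GRing.Theory Num.Theory.
Import numFieldNormedType.Exports.
Local Open Scope ring_scope.

(** * Word length in the elements of degree at most one *)

Ltac mx4_eq := apply: f_equal;
  repeat (match goal with |- (_ :: _) = (_ :: _) => congr cons end); ring.

Section SmallWords.
Variable F : finFieldType.
Local Notation P := {poly F}.
Implicit Types (A B g h : 'M[P]_4) (M N : 'M[P]_2) (p q x y z : P) (v w : 'rV[P]_2).

(** Listing the rows lets products, transposes and inverses of explicit matrices compute to lists,
    so that identities between them reduce to [ring] entry by entry. *)
Definition mx4 (s : seq (seq P)) : 'M[P]_4 :=
  \matrix_(i < 4, j < 4) nth 0 (nth [::] s i) j.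

Lemma mx4_mul a00 a01 a02 a03 a10 a11 a12 a13 a20 a21 a22 a23 a30 a31 a32 a33
  b00 b01 b02 b03 b10 b11 b12 b13 b20 b21 b22 b23 b30 b31 b32 b33 :
  mx4 [:: [:: a00; a01; a02; a03]; [:: a10; a11; a12; a13];
          [:: a20; a21; a22; a23]; [:: a30; a31; a32; a33]] *m
  mx4 [:: [:: b00; b01; b02; b03]; [:: b10; b11; b12; b13];
          [:: b20; b21; b22; b23]; [:: b30; b31; b32; b33]] =
  mx4 [:: [:: a00 * b00 + a01 * b10 + a02 * b20 + a03 * b30;
              a00 * b01 + a01 * b11 + a02 * b21 + a03 * b31;
              a00 * b02 + a01 * b12 + a02 * b22 + a03 * b32;
              a00 * b03 + a01 * b13 + a02 * b23 + a03 * b33];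
          [:: a10 * b00 + a11 * b10 + a12 * b20 + a13 * b30;
              a10 * b01 + a11 * b11 + a12 * b21 + a13 * b31;
              a10 * b02 + a11 * b12 + a12 * b22 + a13 * b32;
              a10 * b03 + a11 * b13 + a12 * b23 + a13 * b33];
          [:: a20 * b00 + a21 * b10 + a22 * b20 + a23 * b30;
              a20 * b01 + a21 * b11 + a22 * b21 + a23 * b31;
              a20 * b02 + a21 * b12 + a22 * b22 + a23 * b32;
              a20 * b03 + a21 * b13 + a22 * b23 + a23 * b33];
          [:: a30 * b00 + a31 * b10 + a32 * b20 + a33 * b30;
              a30 * b01 + a31 * b11 + a32 * b21 + a33 * b31;
              a30 * b02 + a31 * b12 + a32 * b22 + a33 * b32;
              a30 * b03 + a31 * b13 + a32 * b23 + a33 * b33]].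
Proof.
apply/matrixP => i j; rewrite !mxE !big_ord_recr big_ord0 /= !mxE add0r.
by case: i => [[|[|[|[|?]]]] ?] //; case: j => [[|[|[|[|?]]]] ?].
Qed.

Lemma mx4_tr a00 a01 a02 a03 a10 a11 a12 a13 a20 a21 a22 a23 a30 a31 a32 a33 :
  (mx4 [:: [:: a00; a01; a02; a03]; [:: a10; a11; a12; a13];
          [:: a20; a21; a22; a23]; [:: a30; a31; a32; a33]])^T =
  mx4 [:: [:: a00; a10; a20; a30]; [:: a01; a11; a21; a31];
          [:: a02; a12; a22; a32]; [:: a03; a13; a23; a33]].
Proof.
apply/matrixP => i j; rewrite !mxE.
by case: i => [[|[|[|[|?]]]] ?] //; case: j => [[|[|[|[|?]]]] ?].
Qed.

Lemma mx4_opp a00 a01 a02 a03 a10 a11 a12 a13 a20 a21 a22 a23 a30 a31 a32 a33 :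
  - mx4 [:: [:: a00; a01; a02; a03]; [:: a10; a11; a12; a13];
          [:: a20; a21; a22; a23]; [:: a30; a31; a32; a33]] =
  mx4 [:: [:: - a00; - a01; - a02; - a03]; [:: - a10; - a11; - a12; - a13];
          [:: - a20; - a21; - a22; - a23]; [:: - a30; - a31; - a32; - a33]].
Proof.
apply/matrixP => i j; rewrite !mxE.
by case: i => [[|[|[|[|?]]]] ?] //; case: j => [[|[|[|[|?]]]] ?].
Qed.

Lemma mx4_1 : 1%:M = mx4 [:: [:: 1; 0; 0; 0]; [:: 0; 1; 0; 0]; [:: 0; 0; 1; 0]; [:: 0; 0; 0; 1]].
Proof.
apply/matrixP => i j; rewrite !mxE.
by case: i => [[|[|[|[|?]]]] ?] //; case: j => [[|[|[|[|?]]]] ?].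
Qed.

Lemma Jmx4 : Jmx F = mx4 [:: [:: 0; 0; 0; 1]; [:: 0; 0; 1; 0]; [:: 0; -1; 0; 0]; [:: -1; 0; 0; 0]].
Proof.
apply/matrixP => i j; rewrite !mxE.
by case: i => [[|[|[|[|?]]]] ?] //; case: j => [[|[|[|[|?]]]] ?].
Qed.

Definition i0 : 'I_4 := Ordinal (isT : 0 < 4)%N.
Definition i1 : 'I_4 := Ordinal (isT : 1 < 4)%N.
Definition i2 : 'I_4 := Ordinal (isT : 2 < 4)%N.
Definition i3 : 'I_4 := Ordinal (isT : 3 < 4)%N.

Lemma mx4_eta A : A = mx4
  [:: [:: A i0 i0; A i0 i1; A i0 i2; A i0 i3]; [:: A i1 i0; A i1 i1; A i1 i2; A i1 i3];
      [:: A i2 i0; A i2 i1; A i2 i2; A i2 i3]; [:: A i3 i0; A i3 i1; A i3 i2; A i3 i3]].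
Proof.
apply/matrixP => i j; rewrite !mxE.
case: i => [[|[|[|[|?]]]] ?] //; case: j => [[|[|[|[|?]]]] ?] //=;
  by congr (A _ _); apply/val_inj.
Qed.

Definition msize n A := [forall i, forall j, size (A i j) <= n]%N.

Lemma msizeP n A : reflect (forall i j, size (A i j) <= n)%N (msize n A).
Proof. by apply: (iffP forallP) => H i; [apply/forallP|apply/forallP => j]. Qed.

Lemma msize_mx4 n a00 a01 a02 a03 a10 a11 a12 a13 a20 a21 a22 a23 a30 a31 a32 a33 :
  all (fun a : P => size a <= n)%N [:: a00; a01; a02; a03; a10; a11; a12; a13;
          a20; a21; a22; a23; a30; a31; a32; a33] ->
  msize n (mx4 [:: [:: a00; a01; a02; a03]; [:: a10; a11; a12; a13];
          [:: a20; a21; a22; a23]; [:: a30; a31; a32; a33]]).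
Proof.
move=> H; apply/msizeP => i j; rewrite mxE; apply: (allP H).
by case: i => [[|[|[|[|?]]]] ?] //; case: j => [[|[|[|[|?]]]] ?] //=;
   rewrite !inE ?eqxx ?orbT.
Qed.

Lemma size_mul_leqS m n p q : (size p <= m.+1)%N -> (size q <= n)%N -> (size (p * q)%R <= m + n)%N.
Proof.
move=> pm qn; apply: leq_trans (size_polyMleq p q) _; lia.
Qed.

Lemma msizeM m n A B : msize m.+1 A -> msize n B -> msize (m + n) (A *m B).
Proof.
move=> /msizeP hA /msizeP hB; apply/msizeP => i j; rewrite mxE.
by apply: (leq_trans (size_sum _ _ _)); apply/bigmax_leqP => k _; apply: size_mul_leqS.
Qed.

Definition sp_small A := is_sp4 A && msize 2 A.

(** Words over the finite set of symplectic matrices of degree at most one. As [1%:M] is a letter,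
    words can be padded ([genW]), and [gen k] reads as length at most [k]. *)
Inductive gen : nat -> 'M[P]_4 -> Prop :=
| gen1 : gen 0 1%:M
| genS k A B : sp_small A -> gen k B -> gen k.+1 (A *m B).

Lemma sp_small1 : sp_small 1%:M.
Proof.
rewrite /sp_small sp4_1; apply/msizeP => i j; rewrite mxE.
by case: eqP; rewrite ?size_poly1 ?size_poly0.
Qed.

Lemma genM k l A B : gen k A -> gen l B -> gen (k + l) (A *m B).
Proof.
move=> gA gB; elim: gA => [|k' A1 A2 hA _ IH]; first by rewrite mul1mx.
by rewrite -mulmxA addSn; apply: genS.
Qed.

Lemma gen_small A : sp_small A -> gen 1 A.
Proof. by move=> hA; rewrite -[A]mulmx1; apply: genS => //; apply: gen1. Qed.

Lemma genW k l A : (k <= l)%N -> gen k A -> gen l A.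
Proof.
move=> kl gA; rewrite -(subnK kl); elim: (l - k)%N => [|m IH] //.
by rewrite -[A]mul1mx addSn; apply: genS => //; exact: sp_small1.
Qed.

Lemma gen_sp k A : gen k A -> is_sp4 A.
Proof.
elim=> [|k' A1 A2 /andP[hA _] _ IH]; [exact: sp4_1|exact: sp4_mul].
Qed.

(** Each letter raises degrees by at most one. This controls the coordinates that the word
    constructions below leave unspecified. *)
Lemma gen_msize k A : gen k A -> msize k.+1 A.
Proof.
elim=> [|k' A1 A2 /andP[_ hA] _ IH]; last by rewrite -add1n; apply: msizeM.
by apply/msizeP => i j; rewrite mxE; case: eqP; rewrite ?size_poly1 ?size_poly0.
Qed.

Lemma sp_invK_r A : is_sp4 A -> A *m sp_inv A = 1%:M.
Proof. by move/sp_invK_l/mulmx1C. Qed.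

Lemma sp_invM A B : is_sp4 A -> is_sp4 B -> sp_inv (A *m B) = sp_inv B *m sp_inv A.
Proof.
move=> hA hB; have hAB := sp4_mul hA hB.
have e : A *m B *m (sp_inv B *m sp_inv A) = 1%:M.
  by rewrite mulmxA -(mulmxA A) sp_invK_r// mulmx1 sp_invK_r.
by rewrite -[LHS]mulmx1 -e mulmxA sp_invK_l// mul1mx.
Qed.

Lemma sp_inv4 a00 a01 a02 a03 a10 a11 a12 a13 a20 a21 a22 a23 a30 a31 a32 a33 :
  sp_inv (mx4 [:: [:: a00; a01; a02; a03]; [:: a10; a11; a12; a13];
          [:: a20; a21; a22; a23]; [:: a30; a31; a32; a33]]) =
  mx4 [:: [:: a33; a23; - a13; - a03]; [:: a32; a22; - a12; - a02];
          [:: - a31; - a21; a11; a01]; [:: - a30; - a20; a10; a00]].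
Proof.
rewrite /sp_inv mx4_tr Jmx4 !mx4_mul mx4_opp.
by mx4_eq.
Qed.

Lemma sp_inv_msize n A : msize n A -> msize n (sp_inv A).
Proof.
move/msizeP => H; rewrite [A]mx4_eta sp_inv4; apply: msize_mx4.
by rewrite /= !size_polyN !H.
Qed.

Lemma sp_inv_small A : sp_small A -> sp_small (sp_inv A).
Proof. by case/andP => hA sA; apply/andP; split; [exact: sp4_inv|exact: sp_inv_msize]. Qed.

Lemma gen_inv k A : gen k A -> gen k (sp_inv A).
Proof.
elim=> [|k' A1 A2 hA gA IH].
  have -> : sp_inv 1%:M = 1%:M :> 'M[P]_4 by rewrite -[LHS]mulmx1 sp_invK_l// sp4_1.
  exact: gen1.
rewrite sp_invM ?(gen_sp gA)//; last by case/andP: hA.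
by rewrite -addn1; apply: genM => //; apply/gen_small/sp_inv_small.
Qed.

(** Here [w] is the symplectic form on two columns; by antisymmetry the six pairings of distinct
    columns determine [A^T *m J *m A]. *)
Lemma is_sp4_mx4 a00 a01 a02 a03 a10 a11 a12 a13 a20 a21 a22 a23 a30 a31 a32 a33 :
  let w a0 a1 a2 a3 b0 b1 b2 b3 : P := a0 * b3 + a1 * b2 - a2 * b1 - a3 * b0 in
  is_sp4 (mx4 [:: [:: a00; a01; a02; a03]; [:: a10; a11; a12; a13];
          [:: a20; a21; a22; a23]; [:: a30; a31; a32; a33]]) <->
  [/\ w a00 a10 a20 a30 a01 a11 a21 a31 = 0, w a00 a10 a20 a30 a02 a12 a22 a32 = 0,
      w a00 a10 a20 a30 a03 a13 a23 a33 = 1 &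
  [/\ w a01 a11 a21 a31 a02 a12 a22 a32 = 1, w a01 a11 a21 a31 a03 a13 a23 a33 = 0 &
      w a02 a12 a22 a32 a03 a13 a23 a33 = 0]].
Proof.
move=> w; rewrite /is_sp4 mx4_tr {1}Jmx4 !mx4_mul.
set w01 := w a00 _ _ _ _ _ _ _; set w02 := w a00 _ _ _ _ _ _ _; set w03 := w a00 _ _ _ _ _ _ _.
set w12 := w a01 _ _ _ _ _ _ _; set w13 := w a01 _ _ _ _ _ _ _; set w23 := w a02 _ _ _ _ _ _ _.
set M := (X in X == _); have -> : M = mx4 [:: [:: 0; w01; w02; w03]; [:: - w01; 0; w12; w13];
     [:: - w02; - w12; 0; w23]; [:: - w03; - w13; - w23; 0]].
  rewrite /M /w01 /w02 /w03 /w12 /w13 /w23 /w.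
  by mx4_eq.
split=> [/eqP E|[-> -> -> [-> -> ->]]]; last by rewrite !oppr0 Jmx4.
have e i j : mx4 [:: [:: 0; w01; w02; w03]; [:: - w01; 0; w12; w13];
     [:: - w02; - w12; 0; w23]; [:: - w03; - w13; - w23; 0]] i j = Jmx F i j by rewrite E.
move: (e i0 i1) (e i0 i2) (e i0 i3) (e i1 i2) (e i1 i3) (e i2 i3).
by rewrite !mxE /= => -> -> -> -> -> ->.
Qed.

(** The Heisenberg group, unipotent radical of the stabiliser of the line of the first basis vector,
    with central coordinate [z]. *)
Definition heis x y z := mx4 [:: [:: 1; x; y; z]; [:: 0; 1; 0; y]; [:: 0; 0; 1; - x]; [:: 0; 0; 0; 1]].

Lemma heis_sp4 x y z : is_sp4 (heis x y z).
Proof. by apply/is_sp4_mx4; split; [ring|ring|ring|split; ring]. Qed.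

Lemma heisM x y z x' y' z' :
  heis x y z *m heis x' y' z' = heis (x + x') (y + y') (z + z' + x * y' - y * x').
Proof. by rewrite /heis mx4_mul; mx4_eq. Qed.

Lemma heis_inv x y z : sp_inv (heis x y z) = heis (- x) (- y) (- z).
Proof. by rewrite /heis sp_inv4; mx4_eq. Qed.

Definition mx2 (a b c d : P) : 'M[P]_2 :=
  \matrix_(i < 2, j < 2) nth 0 (nth [::] [:: [:: a; b]; [:: c; d]] i) j.

(* The three embeddings of SL_2 come from the two commuting long roots and from
   the Levi subgroup GL_2 of the Siegel parabolic. *)
Definition emb14 M : 'M[P]_4 :=
  mx4 [:: [:: M 0 0; 0; 0; M 0 1]; [:: 0; 1; 0; 0]; [:: 0; 0; 1; 0]; [:: M 1 0; 0; 0; M 1 1]].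
Definition emb23 M : 'M[P]_4 :=
  mx4 [:: [:: 1; 0; 0; 0]; [:: 0; M 0 0; M 0 1; 0]; [:: 0; M 1 0; M 1 1; 0]; [:: 0; 0; 0; 1]].
Definition embL M : 'M[P]_4 :=
  mx4 [:: [:: M 0 0; M 0 1; 0; 0]; [:: M 1 0; M 1 1; 0; 0];
          [:: 0; 0; M 0 0; - M 0 1]; [:: 0; 0; - M 1 0; M 1 1]].

Lemma mulmx2 m n (M : 'M[P]_(m, 2)) (N : 'M[P]_(2, n)) i j : (M *m N) i j = M i 0 * N 0 j + M i 1 * N 1 j.
Proof. by rewrite mxE big_ord_recr big_ord1 /=; congr (M i _ * N _ j + M i _ * N _ j); apply/val_inj. Qed.

Lemma emb14M M N : emb14 (M *m N) = emb14 M *m emb14 N.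
Proof. by rewrite /emb14 mx4_mul !mulmx2; mx4_eq. Qed.

Lemma embLM M N : embL (M *m N) = embL M *m embL N.
Proof. by rewrite /embL mx4_mul !mulmx2; mx4_eq. Qed.

Lemma emb_sp4 M : M 0 0 * M 1 1 - M 0 1 * M 1 0 = 1 ->
  [/\ is_sp4 (emb14 M), is_sp4 (emb23 M) & is_sp4 (embL M)].
Proof.
move=> /eqP; rewrite subr_eq => /eqP d.
by split; apply/is_sp4_mx4; split; try split; rewrite ?mulr0 ?mul0r ?mulr1 ?mul1r; ring: d.
Qed.


End SmallWords.

(** * Root elements as words of linear length *)

Section RootElements.
Variable F : finFieldType.
Hypothesis F2 : (2 : F) != 0.
Local Notation P := {poly F}.
Implicit Types (A B g h : 'M[P]_4) (M N : 'M[P]_2) (p q x y z : P) (v w u : 'rV[P]_2).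

Lemma mx2_1 : 1%:M = mx2 1 0 0 1 :> 'M[P]_2.
Proof.
apply/matrixP => i j; rewrite !mxE.
by case: i => [[|[|?]] ?] //; case: j => [[|[|?]] ?].
Qed.

Lemma mx2M (a b c d a' b' c' d' : P) : mx2 a b c d *m mx2 a' b' c' d' =
  mx2 (a * a' + b * c') (a * b' + b * d') (c * a' + d * c') (c * b' + d * d').
Proof.
apply/matrixP => i j; rewrite mulmx2 !mxE.
by case: i => [[|[|?]] ?] //; case: j => [[|[|?]] ?].
Qed.

(** The sums [c_0 + c_1 M + ... + c_(n-1) M^(n-1)] with constant [c_i], nested so that each further
    power of [M] costs one conjugation. *)
Fixpoint horner_sum M n u : Prop :=
  if n is m.+1 then exists c : 'rV[F]_2, exists w, horner_sum M m w /\ u = map_mx polyC c + w *m M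
  else u = 0.

Lemma horner_sum0 M n : horner_sum M n 0.
Proof. by elim: n => //= n IH; exists 0, 0; rewrite map_mx0 mul0mx addr0. Qed.

Lemma horner_sumS M n u : horner_sum M n u -> horner_sum M n.+1 u.
Proof.
elim: n u => [|n IH] u; first by move=> ->; exact: horner_sum0.
by move=> -[c [w [hw ->]]]; exists c, w; split => //; exact: IH.
Qed.

Lemma horner_sumD M n u w : horner_sum M n u -> horner_sum M n w -> horner_sum M n (u + w).
Proof.
elim: n u w => [|n IH] u w; first by move=> -> ->; rewrite addr0.
move=> -[c [u' [hu ->]]] -[d [w' [hw ->]]]; exists (c + d), (u' + w').
by rewrite map_mxD mulmxDl addrACA; split => //; exact: IH.
Qed.

Lemma horner_sum_const M n (c : 'rV[F]_2) : horner_sum M n.+1 (map_mx polyC c).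
Proof. by exists c, 0; rewrite mul0mx addr0; split => //; exact: horner_sum0. Qed.

Definition hypA : 'M[P]_2 := mx2 'X 1 (-1) 0.
Definition hypB : 'M[P]_2 := mx2 0 (-1) 1 'X.

Lemma hypAB : hypA *m hypB = 1%:M.
Proof. by rewrite mx2M mx2_1; congr mx2; ring. Qed.

Lemma hypBA : hypB *m hypA = 1%:M.
Proof. by rewrite mx2M mx2_1; congr mx2; ring. Qed.

Lemma hypA_add_hypB : hypA + hypB = 'X%:M.
Proof.
apply/matrixP => i j; rewrite !mxE.
by case: i => [[|[|?]] ?] //; case: j => [[|[|?]] ?] //=; ring.
Qed.

(* Multiplication by X is A + A^-1, so the F-span of the vectors c A^k, |k| <= n,
   contains every vector of polynomials of degree < n. *)
Lemma horner_sum_cover n u : (forall j, size (u 0%R j) <= n)%N ->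
  exists w w', [/\ horner_sum hypA n.+1 w, horner_sum hypB n.+1 w' & u = w + w'].
Proof.
elim: n u => [|n IH] u hu.
  exists 0, 0; rewrite addr0; split; try exact: horner_sum0.
  by apply/rowP => j; rewrite mxE; apply/eqP; rewrite -size_poly_leq0.
pose c : 'rV[F]_2 := \row_j (u 0 j)`_0.
pose u' : 'rV[P]_2 := \row_j ((u 0 j) %/ 'X).
have uE : u = map_mx polyC c + u' *m ('X)%:M.
  apply/rowP => j; rewrite mul_mx_scalar !mxE.
  rewrite {1}(divp_eq (u 0 j) 'X) addrC mulrC; congr (_ + _).
  have := modp_XsubC (u 0 j) 0; rewrite subr0 => ->; rewrite horner_coef0 //.
have [|w [w' [hw hw' e]]] := IH u'.
  move=> j; rewrite mxE size_divp ?polyX_eq0// size_polyX.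
  by rewrite leq_subLR; exact: hu.
have [[a [b [hb eb]]] [a' [b' [hb' eb']]]] := (hw, hw').
(* In [u' (A + A^-1)] the mixed products only lower exponents: [w A^-1] is one new term plus a
   shorter sum in [A], and symmetrically for [w' A]. *)
have wB : w *m hypB = map_mx polyC a *m hypB + b.
  by rewrite eb mulmxDl -mulmxA hypAB mulmx1.
have wA : w' *m hypA = map_mx polyC a' *m hypA + b'.
  by rewrite eb' mulmxDl -mulmxA hypBA mulmx1.
exists (map_mx polyC c + w *m hypA + map_mx polyC a' *m hypA + b).
exists (w' *m hypB + map_mx polyC a *m hypB + b'); split.
- apply: horner_sumD; last by do 2!apply: horner_sumS.
  apply: horner_sumD; first by exists c, w.
  by exists 0, (map_mx polyC a'); rewrite map_mx0 add0r; split => //; exact: horner_sum_const.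
- apply: horner_sumD; last by do 2!apply: horner_sumS.
  apply: horner_sumD; first by exists 0, w'; rewrite map_mx0 add0r.
  by exists 0, (map_mx polyC a); rewrite map_mx0 add0r; split => //; exact: horner_sum_const.
rewrite uE -hypA_add_hypB e mulmxDl !mulmxDr wA wB.
move: (map_mx polyC c) (w *m hypA) (map_mx polyC a *m hypB) (w' *m hypB) => x1 x2 x3 x4.
by move: (map_mx polyC a' *m hypA) => x5; apply/rowP => j; rewrite !mxE; ring.
Qed.

Definition heisv v z := heis (v 0 0) (v 0 1) z.

Lemma emb23_mx2 a b c d : emb23 (mx2 a b c d) =
  mx4 [:: [:: 1; 0; 0; 0]; [:: 0; a; b; 0]; [:: 0; c; d; 0]; [:: 0; 0; 0; 1]] :> 'M[P]_4.
Proof. by rewrite /emb23 !mxE. Qed.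

(** The middle SL_2 preserves the symplectic form behind the Heisenberg cocycle, so it acts linearly
    on [(x, y)] and trivially on [z]. A Horner step thus becomes a conjugation. *)
Lemma heis_conj a b c d x y z : a * d = 1 + b * c ->
  emb23 (mx2 d (- b) (- c) a) *m heis x y z *m emb23 (mx2 a b c d) =
  heis (x * a + y * c) (x * b + y * d) z.
Proof.
move=> e; rewrite !emb23_mx2 /heis !mx4_mul; congr mx4.
repeat (match goal with |- (_ :: _) = (_ :: _) => congr cons end); try (by ring); by ring: e.
Qed.

Lemma small_heis x y z : (size x <= 2)%N -> (size y <= 2)%N -> (size z <= 2)%N ->
  sp_small (heis x y z).
Proof.
move=> hx hy hz; rewrite /sp_small heis_sp4; apply: msize_mx4.
by rewrite /= size_polyN size_poly0 size_poly1 hx hy hz.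
Qed.

Lemma small_emb a b c d : a * d - b * c = 1 -> all (fun p => size p <= 2)%N [:: a; b; c; d] ->
  [/\ sp_small (emb14 (mx2 a b c d)), sp_small (emb23 (mx2 a b c d)) & sp_small (embL (mx2 a b c d))].
Proof.
move=> e; rewrite /= => /and5P[sa sb sc sd _].
have [|h1 h2 h3] := @emb_sp4 F (mx2 a b c d); first by rewrite !mxE.
by split; apply/andP; split => //; apply: msize_mx4;
  rewrite !mxE /= ?size_polyN ?size_poly0 ?size_poly1 ?sa ?sb ?sc ?sd.
Qed.

(** A Horner step costs three letters: two for the conjugation, one for the constant vector. The
    central coordinate is whatever results; [gen_heis] corrects it. *)
Lemma gen_horner a b c d n u : a * d - b * c = 1 -> all (fun p => size p <= 2)%N [:: a; b; c; d] ->
  horner_sum (mx2 a b c d) n u -> exists z, gen (3 * n) (heisv u z).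
Proof.
move=> e s4; elim: n u => [|n IH] u /=.
  move=> ->; exists 0; rewrite /heisv !mxE; have -> : heis 0 0 0 = 1%:M :> 'M[P]_4.
    by rewrite mx4_1 /heis oppr0.
  exact: gen1.
(* The added products are the Heisenberg cocycle of the constant vector and [w M]. *)
move=> [k [w [/IH[z gz] ->]]]; exists (z + (k 0 0)%:P * (w 0 0 * b + w 0 1 * d) - (k 0 1)%:P * (w 0 0 * a + w 0 1 * c)).
have -> : heisv (map_mx polyC k + w *m mx2 a b c d)
     (z + (k 0 0)%:P * (w 0 0 * b + w 0 1 * d) - (k 0 1)%:P * (w 0 0 * a + w 0 1 * c)) =
  heis (k 0 0)%:P (k 0 1)%:P 0 *m (emb23 (mx2 d (- b) (- c) a) *m heisv w z *m emb23 (mx2 a b c d)).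
  rewrite heis_conj; last by rewrite -e subrK.
  have E j : (map_mx polyC k + w *m mx2 a b c d) 0 j =
      (k 0 j)%:P + (w 0 0 * mx2 a b c d 0 j + w 0 1 * mx2 a b c d 1 j).
    by rewrite mxE mulmx2 mxE.
  by rewrite heisM /heisv !E !mxE /=; congr heis; ring.
have -> : (3 * n.+1 = 1 + (1 + 3 * n + 1))%N by lia.
have [_ s1 _] := small_emb e s4.
have [_ s2 _] : [/\ sp_small (emb14 (mx2 d (- b) (- c) a)), sp_small (emb23 (mx2 d (- b) (- c) a)) &
   sp_small (embL (mx2 d (- b) (- c) a))].
  apply: small_emb; first by rewrite -e; ring.
  by move: s4 => /= /and5P[sa sb sc sd _]; rewrite !size_polyN sa sb sc sd.
apply: genM; first by apply/gen_small/small_heis; rewrite ?size_poly0// (leq_trans (size_polyC_leq1 _)).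
by apply: genM; [apply: genM => //|]; exact: gen_small.
Qed.

Lemma gen_heisv n u : (forall j, size (u 0%R j) <= n)%N -> exists z, gen (6 * n.+1) (heisv u z).
Proof.
move=> /horner_sum_cover [w [w' [hw hw' ->]]].
have [||z gz] := gen_horner _ _ hw; [by ring| by rewrite /= size_polyX size_polyN size_poly1 size_poly0|].
have [||z' gz'] := gen_horner _ _ hw'; [by ring| by rewrite /= size_polyX size_polyN size_poly1 size_poly0|].
exists (z + z' + w 0 0 * w' 0 1 - w 0 1 * w' 0 0).
have -> : heisv (w + w') (z + z' + w 0 0 * w' 0 1 - w 0 1 * w' 0 0) = heisv w z *m heisv w' z'.
  by rewrite /heisv heisM !mxE.
by have -> : (6 * n.+1 = 3 * n.+1 + 3 * n.+1)%N; [lia|apply: genM].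
Qed.

(** The commutator of [heis z 0 t] with [heis 0 2^-1 0] is [heis 0 0 z] whatever the unknown [t] is;
    here 2 has to be invertible. *)
Lemma gen_centre n z : (size z <= n)%N -> gen (12 * n + 14) (heis 0 0 z).
Proof.
move=> zn; pose u : 'rV[P]_2 := \row_j (if j == 0 then z else 0).
have [|t gt] := @gen_heisv n u.
  by move=> j; rewrite mxE; case: ifP; rewrite ?size_poly0.
have ut : heisv u t = heis z 0 t by rewrite /heisv !mxE.
pose b := heis 0 (2^-1)%:P 0 : 'M[P]_4.
have gb : gen 1 b.
  by apply/gen_small/small_heis; rewrite ?size_poly0// (leq_trans (size_polyC_leq1 _)).
have -> : heis 0 0 z = heisv u t *m b *m sp_inv (heisv u t) *m sp_inv b.
  rewrite ut /b !heis_inv !heisM; congr heis; try ring.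
  have e : (2^-1)%:P + (2^-1)%:P = 1 :> P.
    by rewrite -polyCD; congr polyC; rewrite -[LHS](mulfK F2) mulrDl mulVf// divff.
  by rewrite -[LHS]mulr1 -e; ring.
have -> : (12 * n + 14 = 6 * n.+1 + 1 + 6 * n.+1 + 1)%N by lia.
by do 3?[apply: genM => //]; exact: gen_inv.
Qed.

Lemma gen_heis n x y z : (size x <= n)%N -> (size y <= n)%N -> (size z <= n)%N ->
  gen (110 * n.+1) (heis x y z).
Proof.
move=> xn yn zn; pose u : 'rV[P]_2 := \row_j (if j == 0 then x else y).
have [|t gt] := @gen_heisv n u.
  by move=> j; rewrite mxE; case: ifP.
have ut : heisv u t = heis x y t by rewrite /heisv !mxE.
(* The length of the word bounds the degree of its unknown centre, so the correction by [z - t] is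
   again linear in [n]. *)
have st : (size t <= 6 * n.+1 + 1)%N.
  by have /msizeP/(_ i0 i3) := gen_msize gt; rewrite ut mxE /= addn1.
have gz : gen (12 * (6 * n.+1 + 1) + 14) (heis 0 0 (z - t)).
  apply: gen_centre; rewrite (leq_trans (size_polyD _ _))// size_polyN geq_max st andbT.
  by rewrite (leq_trans zn)//; lia.
have -> : heis x y z = heisv u t *m heis 0 0 (z - t).
  by rewrite ut heisM; congr heis; ring.
by apply: (genW _ (genM gt gz)); lia.
Qed.
End RootElements.

(** * Reduction to the identity by Euclid's algorithm *)

Section EuclideanReduction.
Variable F : finFieldType.
Hypothesis F2 : (2 : F) != 0.
Local Notation P := {poly F}.
Implicit Types (A B g h : 'M[P]_4) (M N : 'M[P]_2) (p q x y z : P).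

Inductive elem2 : nat -> 'M[P]_2 -> Prop :=
| elem2_1 : elem2 0 1%:M
| elem2_E k p M : elem2 k M -> elem2 (k + (size p).+1) (M *m mx2 1 p 0 1)
| elem2_w k M : elem2 k M -> elem2 k.+1 (M *m mx2 0 1 (-1) 0).

(** The bound is a potential: passing from [(x, y)] to [(y, - (x %% y))] lowers
    [size x + 3 * size y] by at least the cost of the quotient and of the rotation. *)
Lemma elem2_euclid x y : exists k M,
  [/\ elem2 k M, (k <= size x + 3 * size y)%N & M 1 0 * x + M 1 1 * y = 0].
Proof.
have [n] := ubnP (size y); elim: n x y => // n IH x y yn.
have [->|y0] := eqVneq y 0.
  by exists 0%N, 1%:M; rewrite !mxE /= mul0r mulr0 addr0; split => //; exact: elem2_1.
have sr : (size (x %% y)%R < size y)%N by rewrite ltn_modp.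
have [|k [M [gM kM e]]] := IH y (- (x %% y)).
  by rewrite size_polyN; apply: leq_trans sr _.
exists (k.+1 + (size (- (x %/ y))%R).+1)%N, (M *m mx2 0 1 (-1) 0 *m mx2 1 (- (x %/ y)) 0 1); split.
- by apply/elem2_E/elem2_w.
- move: kM; rewrite !size_polyN size_divp//.
  have : (0 < size y)%N by rewrite size_poly_gt0.
  have [xy|yx] := ltnP (size x) (size y).
    by rewrite modp_small//; move: (size x) (size y) xy => a b; lia.
  move: (size x) (size y) (size (x %% y)) sr yx => a b r; lia.
rewrite !mulmx2 !mxE /=; apply: etrans e; have := divp_eq x y.
by move: (x %/ y) (x %% y) => q r ->; ring.
Qed.

Lemma gen_of_elem2 (f : 'M[P]_2 -> 'M[P]_4) k M : f 1%:M = 1%:M ->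
  (forall M N, f (M *m N) = f M *m f N) ->
  (forall p, gen (110 * (size p).+1) (f (mx2 1 p 0 1))) ->
  gen 1 (f (mx2 0 1 (-1) 0)) -> elem2 k M -> gen (110 * k) (f M).
Proof.
move=> f1 fM fE fw; elim=> [|k' p N _ IH|k' N _ IH].
- by rewrite f1; exact: gen1.
- by rewrite fM mulnDr; apply: genM.
- by rewrite fM; apply: (genW _ (genM IH fw)); lia.
Qed.

Definition swap4 : 'M[P]_4 :=
  mx4 [:: [:: 0; 1; 0; 0]; [:: 1; 0; 0; 0]; [:: 0; 0; 0; 1]; [:: 0; 0; 1; 0]].

Lemma swap4_small : sp_small swap4.
Proof.
apply/andP; split; last by apply: msize_mx4; rewrite /= size_poly0 size_poly1.
by apply/is_sp4_mx4; split; [ring|ring|ring|split; ring].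
Qed.

Lemma gen_emb k M : elem2 k M ->
  [/\ gen (110 * k) (emb14 M), gen (2 + 110 * k) (emb23 M) & gen (110 * k) (embL M)].
Proof.
move=> hM; have [w14 _ wL] : [/\ sp_small (emb14 (mx2 0 1 (-1) 0 : 'M[P]_2)),
     sp_small (emb23 (mx2 0 1 (-1) 0 : 'M[P]_2)) & sp_small (embL (mx2 0 1 (-1) 0 : 'M[P]_2))].
  by apply: small_emb; [ring|rewrite /= size_polyN size_poly0 size_poly1].
have g14 : gen (110 * k) (emb14 M).
  apply: gen_of_elem2 hM; [|exact: emb14M| |exact: gen_small].
    by rewrite /emb14 !mxE /= mx4_1.
  move=> p; have -> : emb14 (mx2 1 p 0 1) = heis 0 0 p by rewrite /emb14 /heis !mxE /= oppr0.
  by apply: gen_heis => //; rewrite size_poly0.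
split=> //.
(* The Weyl element [swap4] exchanges the two long root SL_2, at the price of two letters. *)
- have -> : emb23 M = swap4 *m emb14 M *m sp_inv swap4.
    by rewrite /swap4 sp_inv4 /emb14 /emb23 !mx4_mul; mx4_eq.
  have -> : (2 + 110 * k = 1 + 110 * k + 1)%N by lia.
  apply: genM; last by apply/gen_inv/gen_small/swap4_small.
  by apply: genM => //; apply/gen_small/swap4_small.
- apply: gen_of_elem2 hM; [|exact: embLM| |exact: gen_small].
    by rewrite /embL !mxE /= oppr0 mx4_1.
  move=> p; have -> : embL (mx2 1 p 0 1) = heis p 0 0 by rewrite /embL /heis !mxE /= oppr0.
  by apply: gen_heis => //; rewrite size_poly0.
Qed.

Definition reduces (Q Q' : 'M[P]_4 -> Prop) := exists C, forall n g,
  is_sp4 g -> msize n g -> Q g -> exists2 h, gen (C * n.+1) h & Q' (h *m g).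

(** A word of linear length enlarges degrees only linearly ([gen_msize]), so the second stage still
    needs a word linear in the original [n]. *)
Lemma reduces_trans Q Q' Q'' : reduces Q Q' -> reduces Q' Q'' -> reduces Q Q''.
Proof.
move=> [C1 H1] [C2 H2]; exists (C1 + C2 * (C1 + 1))%N => n g sg mg Qg.
have [h gh Q'g] := H1 n g sg mg Qg.
have mh := msizeM (gen_msize gh) mg.
have [h' gh' Q''g] := H2 _ _ (sp4_mul (gen_sp gh) sg) mh Q'g.
exists (h' *m h); last by rewrite -mulmxA.
by apply: (genW _ (genM gh' gh)); nia.
Qed.

Lemma reduces_emb (f : 'M[P]_2 -> 'M[P]_4) (r s c : 'I_4) (Q Q' : 'M[P]_4 -> Prop) :
  (forall k M, elem2 k M -> gen (2 + 110 * k) (f M)) ->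
  (forall M g, Q g -> M 1 0 * g r c + M 1 1 * g s c = 0 -> Q' (f M *m g)) ->
  reduces Q Q'.
Proof.
(* Euclid gives [k <= n + 3 * n], and [2 + 110 * (4 * n)] is at most [442 * n.+1]. *)
move=> gf QQ'; exists 442%N => n g sg /msizeP mg Qg.
have [k [M [hM kM e]]] := elem2_euclid (g r c) (g s c).
exists (f M); last exact: QQ'.
by apply: (genW _ (gf k M hM)); have := mg r c; have := mg s c; lia.
Qed.

(** Clearing from the bottom keeps the zeros already made: [emb23] leaves rows 0 and 3 alone, and
    [embL] mixes rows 2 and 3 only once both entries vanish. *)
Lemma reduces_col0 : reduces (fun=> True)
  (fun g => [/\ g i1 i0 = 0, g i2 i0 = 0 & g i3 i0 = 0]).
Proof.
apply: (@reduces_trans _ (fun g => g i3 i0 = 0)).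
  apply: (@reduces_emb (@emb14 F) i0 i3 i0).
    by move=> k M /gen_emb[g14 _ _]; apply: genW g14; rewrite addnC leq_addr.
  move=> M g _ e; rewrite [g]mx4_eta /emb14 mx4_mul mxE /= -[RHS]e; ring.
apply: (@reduces_trans _ (fun g => g i2 i0 = 0 /\ g i3 i0 = 0)).
  apply: (@reduces_emb (@emb23 F) i1 i2 i0).
    by move=> k M /gen_emb[].
  move=> M g g3 e; rewrite [g]mx4_eta /emb23 mx4_mul !mxE /= g3.
  by split; [rewrite -[RHS]e|]; ring.
apply: (@reduces_emb (@embL F) i0 i1 i0).
  by move=> k M /gen_emb[_ _ gL]; apply: genW gL; rewrite addnC leq_addr.
move=> M g [g2 g3] e; rewrite [g]mx4_eta /embL mx4_mul !mxE /= g2 g3.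
by split; [rewrite -[RHS]e| |]; ring.
Qed.

Lemma mulP_eq1 p q : p * q = 1 -> exists2 c : F, c != 0 & p = c%:P.
Proof.
move=> pq; have pU : p \is a GRing.unit.
  by apply/unitrP; exists q; rewrite mulrC pq.
by move: pU; rewrite poly_unitE => /andP[/size_poly1P[c c0 ->] _]; exists c.
Qed.

Lemma small_diag (c : F) : c != 0 -> let D := mx2 c^-1%:P 0 0 c%:P in
  sp_small (emb14 D) /\ sp_small (emb23 D).
Proof.
move=> c0 D; have [||h1 h2 _] := @small_emb F c^-1%:P 0 0 c%:P; [| |by []].
  by rewrite mulr0 subr0 -polyCM mulVf.
by rewrite /= size_poly0 !(leq_trans (size_polyC_leq1 _)).
Qed.

(** Once the first column is a basis vector, the symplectic relations fix the last row and leave a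
    middle block of determinant 1, to which the Euclidean scheme applies through [emb23]. *)
Lemma reduces_heis : reduces (fun=> True) (fun g => exists x y z, g = heis x y z).
Proof.
apply: (reduces_trans reduces_col0).
apply: (@reduces_trans _ (fun g => [/\ g i0 i0 = 1, g i1 i0 = 0, g i2 i0 = 0 & g i3 i0 = 0])).
  exists 1%N => n g; rewrite [g]mx4_eta => sg _; rewrite !mxE /= => -[g1 g2 g3].
  have [_ _ /mulP_eq1-[c c0 e] _] : [/\ True, True, g i0 i0 * g i3 i3 = 1 & True].
    by move/is_sp4_mx4: sg => [_ _ e _]; split=> //; rewrite -[RHS]e g1 g2 g3; ring.
  exists (emb14 (mx2 c^-1%:P 0 0 c%:P)).
    by apply: (@genW _ 1); rewrite ?mul1n//; apply/gen_small; case: (small_diag c0).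
  rewrite /emb14 mx4_mul !mxE /= g1 g2 g3 e; split; try by ring.
  by rewrite -polyCM mulVf//; ring.
have row3 g : is_sp4 g -> [/\ g i0 i0 = 1, g i1 i0 = 0, g i2 i0 = 0 & g i3 i0 = 0] ->
    [/\ g i3 i1 = 0, g i3 i2 = 0, g i3 i3 = 1 & g i1 i1 * g i2 i2 - g i2 i1 * g i1 i2 = 1].
  rewrite [g]mx4_eta => /is_sp4_mx4[e1 e2 e3 [e4 _ _]]; rewrite !mxE /= => -[g0 g1 g2 g3].
  have h1 : g i3 i1 = 0 by rewrite -[RHS]e1 g0 g1 g2 g3; ring.
  have h2 : g i3 i2 = 0 by rewrite -[RHS]e2 g0 g1 g2 g3; ring.
  split=> //; first by rewrite -[RHS]e3 g0 g1 g2 g3; ring.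
  by rewrite -[RHS]e4 h1 h2; ring.
apply: (@reduces_trans _ (fun g => [/\ g i0 i0 = 1, g i1 i0 = 0, g i2 i0 = 0 & g i3 i0 = 0]
    /\ g i2 i1 = 0)).
  apply: (@reduces_emb (@emb23 F) i1 i2 i1).
    by move=> k M /gen_emb[].
  move=> M g [g0 g1 g2 g3] e; rewrite [g]mx4_eta /emb23 mx4_mul !mxE /= g0 g1 g2 g3.
  by split; [split; ring|rewrite -[RHS]e; ring].
apply: (@reduces_trans _ (fun g => [/\ g i0 i0 = 1, g i1 i0 = 0, g i2 i0 = 0 & g i3 i0 = 0]
    /\ [/\ g i2 i1 = 0, g i1 i1 = 1 & g i2 i2 = 1])).
  exists 1%N => n g sg _ [h0 h1].
  have [_ _ _ e] := row3 g sg h0.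
  have /mulP_eq1[c c0 e1] : g i1 i1 * g i2 i2 = 1 by rewrite -e h1; ring.
  exists (emb23 (mx2 c^-1%:P 0 0 c%:P)).
    by apply: (@genW _ 1); rewrite ?mul1n//; apply/gen_small; case: (small_diag c0).
  case: h0 => g0 g1 g2 g3; rewrite [g]mx4_eta /emb23 mx4_mul !mxE /= g0 g1 g2 g3 h1.
  split; [by split; ring|split; first by ring].
    by rewrite e1 -polyCM mulVf//; ring.
  by rewrite -[RHS]e h1 e1; ring.
apply: (@reduces_trans _ (fun g => [/\ g i0 i0 = 1, g i1 i0 = 0, g i2 i0 = 0 & g i3 i0 = 0]
    /\ [/\ g i2 i1 = 0, g i1 i1 = 1, g i2 i2 = 1 & g i1 i2 = 0])).
  exists 112%N => n g _ /msizeP mg [[g0 g1 g2 g3] [h1 h2 h3]].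
  exists (emb23 (mx2 1 (- g i1 i2) 0 1)).
    have := elem2_E (- g i1 i2) elem2_1; rewrite mul1mx => /gen_emb[_ g23 _].
    by apply: genW g23; rewrite size_polyN; move: (size _) (mg i1 i2) => s; lia.
  rewrite [g]mx4_eta /emb23 mx4_mul !mxE /= g0 g1 g2 g3 h1 h2 h3.
  by split; [split; ring|split; ring].
exists 0%N => n g sg _ [h0 [h1 h2 h3 h4]]; exists 1%:M; first exact: gen1.
rewrite mul1mx; have [e1 e2 e3 _] := row3 g sg h0.
case: h0 => g0 g1 g2 g3; exists (g i0 i1), (g i0 i2), (g i0 i3).
(* The relations of columns 1 and 2 with column 3 tie the last column to the first row, as in
   [heis]. *)
move: sg; rewrite {1}[g]mx4_eta => /is_sp4_mx4[_ _ _ [_]].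
rewrite e1 e2 e3 h1 h2 h3 h4 => f1 f2; rewrite [LHS]mx4_eta /heis g0 g1 g2 g3 e1 e2 e3 h1 h2 h3 h4.
have -> : g i2 i3 = - g i0 i1 by apply/eqP; rewrite -subr_eq0 opprK -[X in _ == X]f1; apply/eqP; ring.
by have -> : g i1 i3 = g i0 i2 by apply/eqP; rewrite -subr_eq0 -oppr_eq0 -[X in _ == X]f2; apply/eqP; ring.
Qed.

Lemma sp4_gen_linear : exists C, forall n g, is_sp4 g -> msize n g -> gen (C * n.+1) g.
Proof.
have [C H] : reduces (fun=> True) (fun g => g = 1%:M).
  apply: (reduces_trans reduces_heis); exists 110%N => n g sg /msizeP mg [x [y [z gE]]].
  exists (sp_inv g); last exact: sp_invK_l.
  apply: gen_inv; rewrite gE; move: (mg i0 i1) (mg i0 i2) (mg i0 i3).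
  by rewrite gE !mxE /=; apply: gen_heis.
exists C => n g sg mg; have [h gh e] := H n g sg mg I.
have -> : g = sp_inv h by rewrite -[RHS]mulmx1 -e mulmxA sp_invK_l ?mul1mx// (gen_sp gh).
exact: gen_inv.
Qed.
End EuclideanReduction.

(** * Group laws in [Sp4] *)

Section GroupLaws.
Variable F : finFieldType.
Local Notation G := (Sp4 F).
Implicit Types g h k : G.

Lemma mulGA g h k : mulG g (mulG h k) = mulG (mulG g h) k.
Proof. by apply: val_inj; rewrite /= mulmxA. Qed.
Lemma mul1G g : mulG (oneG F) g = g.
Proof. by apply: val_inj; rewrite /= mul1mx. Qed.
Lemma mulG1 g : mulG g (oneG F) = g.
Proof. by apply: val_inj; rewrite /= mulmx1. Qed.
Lemma mulVG g : mulG (invG g) g = oneG F.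
Proof. by apply: val_inj; rewrite /= sp_invK_l// (valP g). Qed.
Lemma mulGV g : mulG g (invG g) = oneG F.
Proof. by apply: val_inj; rewrite /= sp_invK_r// (valP g). Qed.
Lemma mulKG g h : mulG (invG g) (mulG g h) = h.
Proof. by rewrite mulGA mulVG mul1G. Qed.
Lemma mulKVG g h : mulG g (mulG (invG g) h) = h.
Proof. by rewrite mulGA mulGV mul1G. Qed.
Lemma invGK g : invG (invG g) = g.
Proof. by rewrite -[LHS]mulG1 -(mulVG g) mulKG. Qed.
Lemma invMG g h : invG (mulG g h) = mulG (invG h) (invG g).
Proof. by apply: val_inj; rewrite /= sp_invM// ?(valP g) ?(valP h). Qed.
End GroupLaws.

(** * The length function and its comparison with word length *)

Section Length.
Variable (R : realType) (F : finFieldType).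
Hypothesis F2 : (2 : F) != 0.
Local Notation G := (Sp4 F).
Local Notation P := {poly F}.
Implicit Types (A B : 'M[P]_4) (g h : G) (p q a b c : P).

Definition minor2 A i j k l : P := A i k * A j l - A i l * A j k.

(** The minors are the entries of the exterior square. The entries of [A] alone would give all
    points of the Siegel coset used below the same length. *)
Definition hgt A : nat := maxn (\max_(i < 4) \max_(j < 4) size (A i j))
  (\max_(i < 4) \max_(j < 4) \max_(k < 4) \max_(l < 4) size (minor2 A i j k l)).

Lemma hgt_leqP n A : reflect ((forall i j, (size (A i j) <= n)%N) /\
   forall i j k l, (size (minor2 A i j k l) <= n)%N) (hgt A <= n)%N.
Proof.
rewrite geq_max; apply: (iffP andP) => -[H1 H2]; split.
- by move=> i j; move/bigmax_leqP: H1 => /(_ i isT) /bigmax_leqP/(_ j isT).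
- move=> i j k l; move/bigmax_leqP: H2 => /(_ i isT) /bigmax_leqP/(_ j isT).
  by move=> /bigmax_leqP/(_ k isT) /bigmax_leqP/(_ l isT).
- by apply/bigmax_leqP => i _; apply/bigmax_leqP => j _; exact: H1.
- do 4!(apply/bigmax_leqP => ? _); exact: H2.
Qed.

Lemma size_sum_leq (I : finType) (E : I -> P) n : (forall i, size (E i) <= n)%N -> (size (\sum_i E i)%R <= n)%N.
Proof. by move=> H; apply: (leq_trans (size_sum _ _ _)); apply/bigmax_leqP => i _. Qed.

Lemma size_mul_leqD p q m n : (size p <= m)%N -> (size q <= n)%N -> (size (p * q : P)%R <= m + n)%N.
Proof. by move=> pm qn; apply: leq_trans (size_polyMleq p q) _; apply: leq_trans (leq_pred _) _; exact: leq_add. Qed.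

(* Cauchy-Binet for 2 x 2 minors, summed over ordered rather than increasing pairs. *)
Lemma minor2M A B i j k l : minor2 (A *m B) i j k l *+ 2 =
  \sum_s \sum_t minor2 A i j s t * minor2 B s t k l.
Proof.
have E i' j' k' l' : (A *m B) i' k' * (A *m B) j' l' =
    \sum_s \sum_t A i' s * A j' t * (B s k' * B t l').
  rewrite !mxE big_distrl /=; apply: eq_bigr => s _; rewrite big_distrr /=.
  by apply: eq_bigr => t _; ring.
have X i' j' k' l' : (A *m B) i' k' * (A *m B) j' l' =
    \sum_s \sum_t A i' t * A j' s * (B t k' * B s l').
  by rewrite E exchange_big.
rewrite mulr2n {1}/minor2 (E i j k l) (E i j l k) /minor2 (X i j k l) (X i j l k).
rewrite -!sumrB -big_split /=; apply: eq_bigr => s _; rewrite -!sumrB -big_split /=.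
by apply: eq_bigr => t _; ring.
Qed.

Lemma hgtM A B : (hgt (A *m B) <= hgt A + hgt B)%N.
Proof.
have /hgt_leqP[hA mA] := leqnn (hgt A); have /hgt_leqP[hB mB] := leqnn (hgt B).
apply/hgt_leqP; split=> [i j|i j k l].
  by rewrite mxE; apply: size_sum_leq => s; exact: size_mul_leqD.
have -> : size (minor2 (A *m B) i j k l) = size (minor2 (A *m B) i j k l *+ 2).
  by rewrite -mulr_natl -polyC_natr mul_polyC size_scale.
by rewrite minor2M; do 2![apply: size_sum_leq => ?]; exact: size_mul_leqD.
Qed.

(** The identity has [hgt] equal to 1, whereas comparison with the word length forces the value 0
    there. *)
Definition ell g : R := if g == oneG F then 0 else (hgt (val g))%:R.

Lemma ell_le_hgt g : ell g <= (hgt (val g))%:R.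
Proof. by rewrite /ell; case: ifP. Qed.

Lemma ell_length : length_function ell.
Proof.
split=> [g|g h]; first by rewrite /ell; case: ifP.
rewrite {2 3}/ell; case: eqP => [->|_]; first by rewrite mul1G add0r; rewrite /ell.
case: eqP => [->|_]; first by rewrite mulG1 addr0 ell_le_hgt.
by apply: le_trans (ell_le_hgt _) _; rewrite -natrD ler_nat hgtM.
Qed.

(** A matrix of degree at most one is given by two coefficient matrices over the finite field;
    [insub] keeps the symplectic ones. *)
Lemma small_seq : exists S : seq G, forall g, sp_small (val g) -> g \in S.
Proof.
pose S := pmap (insub : 'M[P]_4 -> option G)
  [seq map_mx polyC X.1 + 'X *: map_mx polyC X.2 | X : ('M[F]_4 * 'M[F]_4)%type].
exists S => g /andP[_ /msizeP sg]; rewrite mem_pmap_sub; apply/mapP.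
exists (map_mx (fun p : P => p`_0) (val g), map_mx (fun p : P => p`_1) (val g)).
  by rewrite mem_enum.
apply/matrixP => i j; rewrite !mxE; apply/polyP => n.
rewrite coefD coefC coefXM coefC; case: n => [|[|n]] //=; rewrite ?addr0 ?add0r //.
by rewrite nth_default// (leq_trans (sg i j)).
Qed.

Lemma is_word_cat (S : seq G) w w' g g' : is_word S w g -> is_word S w' g' ->
  is_word S (w ++ w') (mulG g g').
Proof.
move=> [aw ->] [aw' ->]; split; first by rewrite all_cat aw.
by rewrite foldr_cat; elim: w {aw} => [|x w IH] /=; rewrite ?mul1G// -mulGA IH.
Qed.

Lemma gen_is_word (S T : seq G) m : (forall g, sp_small (val g) -> g \in T) ->
  (forall t, t \in T -> exists2 w, is_word S w t & (size w <= m)%N) ->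
  forall k A, gen k A -> forall g, val g = A -> exists2 w, is_word S w g & (size w <= m * k)%N.
Proof.
move=> hT hw k A; elim=> [|k' B C sB gC IH] g gE.
  by exists [::] => //; split => //; apply: val_inj; rewrite gE.
have spB : is_sp4 B by case/andP: sB.
pose b : G := exist _ B spB; pose c : G := exist _ C (gen_sp gC).
have [w ww sw] := IH c erefl.
have [w' ww' sw'] := hw b (hT b sB).
have -> : g = mulG b c by apply: val_inj; rewrite gE.
by exists (w' ++ w); [exact: is_word_cat|rewrite size_cat mulnS leq_add].
Qed.

Lemma sp4_finitely_generated : exists S : seq G, generates S.
Proof.
have [T hT] := small_seq; exists T => g; have [C H] := sp4_gen_linear F2.
have /hgt_leqP[/msizeP mg _] := leqnn (hgt (val g)).
have [|w ww _] := @gen_is_word T T 1 hT _ _ _ (H _ _ (valP g) mg) g erefl; last by exists w.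
move=> t tT; exists [:: t] => //; split; last by rewrite /= mulG1.
by rewrite /= mem_cat tT.
Qed.

Lemma hgt_gt0 g : (0 < hgt (val g))%N.
Proof.
rewrite lt0n -leqn0; apply/negP => /hgt_leqP[H _].
have g0 : val g = 0 by apply/matrixP => i j; apply/eqP; rewrite mxE -size_poly_leq0.
have := mulVG g => /(congr1 val) /=; rewrite g0 mulmx0 => /matrixP/(_ i0 i0).
by rewrite !mxE /= => /esym/eqP; rewrite oner_eq0.
Qed.

Lemma ell_bilipschitz (S : seq G) : generates S -> bilipschitz_to_word ell S.
Proof.
move=> genS; have [wd hwd] := choice genS.
have [T hT] := small_seq; have [C H] := sp4_gen_linear F2.
pose m := (\max_(t <- T) size (wd t))%N.
pose M := (\max_(s <- S ++ map (@invG F) S) hgt (val s))%N.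
(* [M] bounds the height of a letter, [m] the length over [S] of an element of [T]; the factor 2
   absorbs [n.+1 <= 2 * n] for a positive height [n]. *)
exists (M + 2 * m * C).+1%:R; split=> [|g]; first by rewrite ltr0n.
split=> [w [aw ->]|].
  elim: w aw => [_|s w IH /= /andP[sS aw]]; first by rewrite /= /ell eqxx mulr0.
  apply: le_trans (proj2 ell_length _ _) _; have -> : (size (s :: w))%:R = 1 + (size w)%:R :> R by rewrite nat1r.
  rewrite mulrDr mulr1.
  apply: lerD; last exact: IH.
  apply: le_trans (ell_le_hgt _) _; rewrite ler_nat -addnS.
  by apply: leq_trans (leq_addr _ _); apply: (@leq_bigmax_seq _ _ _ (fun s : G => hgt (val s))).
have /hgt_leqP[/msizeP mg _] := leqnn (hgt (val g)).
have [|w ww sw] := @gen_is_word S T m hT _ _ _ (H _ _ (valP g) mg) g erefl.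
  by move=> t tT; exists (wd t) => //; apply: (@leq_bigmax_seq _ _ _ (fun s : G => size (wd s))).
rewrite /ell; case: eqP => [->|_]; first by exists [::]; rewrite mulr0.
exists w; split=> //; rewrite -natrM ler_nat (leq_trans sw)//.
by have := hgt_gt0 g; move: (hgt _) => n n0; nia.
Qed.

End Length.

(** * Lengths in the Siegel unipotent radical *)

Section Siegel.
Variable F : finFieldType.
Local Notation G := (Sp4 F).
Local Notation P := {poly F}.
Implicit Types a b c : P.

Definition siegel (a b c : P) : 'M[P]_4 :=
  mx4 [:: [:: 1; 0; a; b]; [:: 0; 1; c; a]; [:: 0; 0; 1; 0]; [:: 0; 0; 0; 1]].

Lemma siegel_sp4 a b c : is_sp4 (siegel a b c).
Proof. by apply/is_sp4_mx4; split; [ring|ring|ring|split; ring]. Qed.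

Definition uG a b c : G := exist _ (siegel a b c) (siegel_sp4 a b c).

Lemma uGM a b c a' b' c' : mulG (uG a b c) (uG a' b' c') = uG (a + a') (b + b') (c + c').
Proof. by apply: val_inj; rewrite /= /siegel mx4_mul; mx4_eq. Qed.

Lemma uG0 : uG 0 0 0 = oneG F.
Proof. by apply: val_inj; rewrite /= /siegel mx4_1. Qed.

Lemma uG_inj a b c a' b' c' : uG a b c = uG a' b' c' -> [/\ a = a', b = b' & c = c'].
Proof.
move=> /(congr1 val) /= /matrixP e; move: (e i0 i2) (e i0 i3) (e i1 i2).
by rewrite !mxE.
Qed.

(** Up to sign, the minors of [[[1, X], [0, 1]]] are 0, 1, the entries of [X] and [det X]. *)
Lemma hgt_siegel a b c n : (0 < n)%N -> size b = n -> (size a <= n)%N -> (size c <= n)%N ->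
  hgt (siegel a b c) = maxn n (size (a ^+ 2 - b * c)).
Proof.
move=> n0 bn an cn; apply/eqP; rewrite eqn_leq; apply/andP; split; last first.
  have /hgt_leqP[H1 H2] := leqnn (hgt (siegel a b c)).
  rewrite geq_max -{1}bn; have := H1 i0 i3; rewrite mxE /= => -> /=.
  by have := H2 i0 i1 i2 i3; rewrite /minor2 !mxE /= expr2.
set N := maxn _ _.
have nN : (n <= N)%N by exact: leq_maxl.
have h0 : (size (0%R : P) <= N)%N by rewrite size_poly0.
have h1 : (size (1%R : P) <= N)%N by rewrite size_poly1; lia.
have ha : (size a <= N)%N by lia.
have hb : (size b <= N)%N by lia.
have hc : (size c <= N)%N by lia.
have hD : (size (a ^+ 2 - b * c)%R <= N)%N by exact: leq_maxr.
have hD' : (size (b * c - a ^+ 2)%R <= N)%N by rewrite -opprB size_polyN.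
apply/hgt_leqP; split=> [i j|].
  rewrite mxE; case: i => [[|[|[|[|?]]]] ?] //; by case: j => [[|[|[|[|?]]]] ?].
move=> i j k l; rewrite /minor2 !mxE.
by case: i => [[|[|[|[|?]]]] ?] //; case: j => [[|[|[|[|?]]]] ?] //;
   case: k => [[|[|[|[|?]]]] ?] //; case: l => [[|[|[|[|?]]]] ?] //=;
  rewrite ?(mulr0, mul0r, mulr1, mul1r, subr0, sub0r, subrr, size_polyN, opprK) -?expr2 ?(mulrC c b) ?(mulrC b a) ?(mulrC c a) ?subrr.
Qed.
End Siegel.

(** * Polynomial approximation of powers *)

(** The Bernstein polynomial, the mean of [g] under the binomial law, defined by conditioning on the
    first trial; its properties follow by induction without binomial coefficients. *)
Fixpoint bernstein (R : realType) (n : nat) (g : nat -> R) : {poly R} :=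
  if n is m.+1 then 'X * bernstein m (g \o S) + (1 - 'X) * bernstein m g else (g 0%N)%:P.

Lemma bernsteinS (R : realType) n (g : nat -> R) x :
  (bernstein n.+1 g).[x] = x * (bernstein n (g \o S)).[x] + (1 - x) * (bernstein n g).[x].
Proof. by rewrite /= !hornerE. Qed.

Lemma ler_bernstein (R : realType) n (g h : nat -> R) x : 0 <= x <= 1 ->
  (forall k, (k <= n)%N -> g k <= h k) -> (bernstein n g).[x] <= (bernstein n h).[x].
Proof.
move=> /andP[x0 x1]; elim: n g h => [|n IH] g h gh; first by rewrite !hornerE gh.
rewrite !bernsteinS lerD// ler_wpM2l ?subr_ge0// IH// => k kn; apply: gh => //.
exact: leqW.
Qed.

Lemma bernsteinZD (R : realType) n (g h : nat -> R) c d x :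
  (bernstein n (fun k => c * g k + d * h k)).[x] =
  c * (bernstein n g).[x] + d * (bernstein n h).[x].
Proof.
elim: n g h => [|n IH] g h; first by rewrite !hornerE.
rewrite !bernsteinS IH.
have -> : (fun k => c * g k + d * h k) \o S = (fun k => c * (g \o S) k + d * (h \o S) k) by [].
by rewrite IH; ring.
Qed.

Lemma bernstein1 (R : realType) n c x : (bernstein n (fun=> c : R)).[x] = c.
Proof.
elim: n => [|n IH]; first by rewrite !hornerE.
by rewrite bernsteinS /comp IH; ring.
Qed.

(** Squared bias plus variance of the binomial law; [c] is arbitrary because the induction shifts
    it. *)
Lemma bernstein_var (R : realType) n c x :
  (bernstein n (fun k => (k%:R - c) ^+ 2)).[x] = (n%:R * x - c) ^+ 2 + n%:R * x * (1 - x) :> R.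
Proof.
elim: n c => [|n IH] c; first by rewrite !hornerE /=; ring.
rewrite bernsteinS IH.
have -> : (fun k : nat => (k%:R - c) ^+ 2) \o S = (fun k : nat => (k%:R - (c - 1)) ^+ 2 : R).
  by apply/funext => k /=; rewrite -natr1; congr (_ ^+ 2); ring.
by rewrite IH -natr1; ring.
Qed.

Lemma lipschitz_poly_approx (R : realType) (h : R -> R) (M L : R) : 0 < M -> 0 < L ->
  (forall s t : R, 0 <= s <= M -> 0 <= t <= M -> `|h s - h t| <= L * `|s - t|) ->
  forall e : R, 0 < e -> exists Q : {poly R}, forall s : R, 0 <= s <= M -> `|Q.[s] - h s| < e.
Proof.
move=> M0 L0 hL e e0.
(* With this choice [L * eta = e / 4], and [X < n] together with [x * (1 - x) <= 1 / 4] makes the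
   variance term at most [e / 4]. *)
pose eta := e / (L * 4).
have eta0 : 0 < eta by rewrite divr_gt0// mulr_gt0.
pose X := L * M ^+ 2 / eta / e.
have X0 : 0 < X by rewrite !divr_gt0// mulr_gt0// exprn_gt0.
pose n := (Num.truncn X).+1.
have Xn : X < n%:R by rewrite /n truncnS_gt.
have n0 : (0 : R) < n%:R by rewrite ltr0n.
pose g k := h (M * (k%:R / n%:R)).
exists (bernstein n g \Po (M^-1 *: 'X)) => s /andP[s0 sM].
rewrite horner_comp hornerZ hornerX.
set x := M^-1 * s.
have x01 : 0 <= x <= 1.
  by rewrite /x mulrC divr_ge0//= ?(ltW M0)// ler_pdivrMr// mul1r.
have sE : s = M * x by rewrite /x mulrA mulfV ?mul1r// gt_eqF.
(* |t| <= eta + t ^ 2 / eta turns the Lipschitz bound into one by the variance *)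
have hb k : (k <= n)%N -> `|g k - h s| <=
    L * eta + L * M ^+ 2 / eta / n%:R ^+ 2 * (k%:R - n%:R * x) ^+ 2.
  move=> kn; apply: le_trans (hL _ _ _ _) _; last 2 first.
  - by rewrite s0 sM.
  - set t := _ - s.
    have tE : M ^+ 2 / n%:R ^+ 2 * (k%:R - n%:R * x) ^+ 2 = t ^+ 2.
      by rewrite /t sE -expr_div_n -exprMn; congr (_ ^+ 2); field; rewrite gt_eqF.
    have -> : L * M ^+ 2 / eta / n%:R ^+ 2 * (k%:R - n%:R * x) ^+ 2
       = L * (t ^+ 2 / eta) by rewrite -tE; ring.
    rewrite -mulrDr ler_wpM2l ?(ltW L0)// -(@ler_pM2r _ eta)// mulrDl divfK ?gt_eqF//.
    have : 0 <= (`|t| - eta) ^+ 2 by rewrite sqr_ge0.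
    have := normr_ge0 t; rewrite -(real_normK (num_real t)); nra.
  - rewrite mulr_ge0 ?divr_ge0 ?(ltW M0) ?(ltW n0)//= -[leRHS]mulr1 ler_wpM2l ?(ltW M0)//.
    by rewrite ler_pdivrMr// mul1r ler_nat.
have V : (bernstein n (fun k => (k%:R - n%:R * x) ^+ 2)).[x] = n%:R * x * (1 - x).
  by rewrite bernstein_var subrr expr0n add0r.
set c := L * M ^+ 2 / eta / n%:R ^+ 2 in hb.
have up : (bernstein n g).[x] <= h s + L * eta + c * (n%:R * x * (1 - x)).
  have := bernsteinZD n (fun=> h s + L * eta) (fun k => (k%:R - n%:R * x) ^+ 2) 1 c x.
  rewrite bernstein1 mul1r V => <-; apply: ler_bernstein => // k kn.
  by have := hb k kn; rewrite ler_norml => /andP[_]; lra.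
have lo : h s - L * eta - c * (n%:R * x * (1 - x)) <= (bernstein n g).[x].
  have := bernsteinZD n (fun=> h s - L * eta) (fun k => (k%:R - n%:R * x) ^+ 2) 1 (- c) x.
  rewrite bernstein1 mul1r V mulNr => <-; apply: ler_bernstein => // k kn.
  by have := hb k kn; rewrite ler_norml => /andP[+ _]; lra.
have small : L * eta + c * (n%:R * x * (1 - x)) < e.
  have -> : L * eta = e / 4 by rewrite /eta; field; rewrite gt_eqF.
  have -> : c * (n%:R * x * (1 - x)) = X / n%:R * e * (x * (1 - x)).
    by rewrite /c /X; field; rewrite !gt_eqF.
  have xx : x * (1 - x) <= 1 / 4.
    by have := sqr_ge0 (x - 1 / 2); rewrite expr2; lra.
  have xx0 : 0 <= x * (1 - x).
    by case/andP: x01 => ? ?; rewrite mulr_ge0// subr_ge0.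
  have Xn1 : X / n%:R < 1 by rewrite ltr_pdivrMr// mul1r.
  have Xn0 : 0 < X / n%:R by rewrite divr_gt0.
  have : X / n%:R * e * (x * (1 - x)) <= e * (1 / 4).
    apply: ler_pM => //; first by rewrite mulr_ge0// ltW.
    by rewrite -[leRHS]mul1r ler_wpM2r ?ltW.
  by lra.
by rewrite ltr_norml; apply/andP; split; lra.
Qed.

(** No derivative is taken: with [u = s / t] in [[0, 1]] and an integer [m >= a], Bernoulli's
    inequality gives [1 - u^a <= 1 - u^m <= m (1 - u)]. *)
Lemma powR_lipschitz (R : realType) (a M : R) : 1 <= a -> 0 < M ->
  exists2 L : R, 0 < L & forall s t : R, 0 <= s <= M -> 0 <= t <= M ->
    `|s `^ a - t `^ a| <= L * `|s - t|.
Proof.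
move=> a1 M0; have a0 : 0 < a by exact: lt_le_trans a1.
pose m := (Num.truncn a).+1.
have am : a <= m%:R by rewrite ltW// truncnS_gt.
exists (M `^ (a - 1) * m%:R); first by rewrite mulr_gt0 ?powR_gt0// ltr0n.
suff H (s t : R) : 0 <= s -> s <= t -> t <= M ->
    t `^ a - s `^ a <= M `^ (a - 1) * m%:R * (t - s).
  move=> s t /andP[s0 sM] /andP[t0 tM].
  wlog st : s t s0 sM t0 tM / s <= t.
    move=> wl; case: (leP s t) => [|/ltW] st; first exact: wl.
    by rewrite distrC (distrC s); exact: wl.
  rewrite distrC (distrC s) !ger0_norm ?subr_ge0//; first exact: H.
  by rewrite ge0_ler_powR// ltW.
have bern (u : R) k : 0 <= u <= 1 -> 1 - u ^+ k <= k%:R * (1 - u).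
  move=> /andP[u0 u1]; elim: k => [|k IH]; first by rewrite expr0 subrr mul0r.
  have : 0 <= u ^+ k <= 1 by rewrite exprn_ge0// exprn_ile1.
  rewrite exprS -natr1; nra.
move=> s0 st tM; have [t0|tn0] := eqVneq t 0.
  have -> : s = t by apply/eqP; rewrite eq_le st t0 s0.
  by rewrite !subrr mulr0.
have t0 : 0 < t by rewrite lt_def tn0 (le_trans s0).
set u := s / t; have sE : s = t * u by rewrite mulrC divfK.
have u01 : 0 <= u <= 1 by rewrite divr_ge0//= ?(ltW t0)// ler_pdivrMr// mul1r.
case/andP: (u01) => u0 u1.
have uu : u ^+ m <= u `^ a.
  have [->|un0] := eqVneq u 0; first by rewrite powR0 ?gt_eqF// expr0n.
  by rewrite -powR_mulrn// ger_powR// u1 lt_def un0 u0.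
rewrite {1}sE powRM ?(ltW t0)// -[X in X - _]mulr1 -mulrBr -(@mulr_powRB1 _ t a) ?(ltW t0)//.
have -> : t - s = t * (1 - u) by rewrite sE; ring.
have ta : t `^ (a - 1) <= M `^ (a - 1).
  by rewrite ge0_ler_powR ?nnegrE ?subr_ge0// ltW// (lt_le_trans t0).
have h1 : 1 - u `^ a <= m%:R * (1 - u).
  by apply: le_trans (bern u m u01); rewrite lerD2l lerN2.
rewrite [t * _]mulrC -!mulrA. apply: ler_pM => //; first exact: powR_ge0.
  rewrite mulr_ge0 ?(ltW t0)// subr_ge0.
  have <- : (1 : R) `^ a = 1 by rewrite powR1.
  by rewrite ge0_ler_powR ?nnegrE ?(ltW a0).
by rewrite mulrCA ler_wpM2l ?(ltW t0).
Qed.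

Lemma powR_poly_approx (R : realType) (a M : R) : 1 <= a -> 0 < M ->
  exists Q : nat -> {poly R}, forall e : R, 0 < e -> exists N : nat,
    forall n : nat, (N <= n)%N -> forall s : R, 0 <= s <= M -> `|(Q n).[s] - s `^ a| < e.
Proof.
move=> a1 M0; have [L L0 hL] := powR_lipschitz a1 M0.
have H (n : nat) : exists Q : {poly R}, forall s : R, 0 <= s <= M -> `|Q.[s] - s `^ a| < n.+1%:R^-1.
  by apply: (lipschitz_poly_approx M0 L0 hL); rewrite invr_gt0 ltr0n.
have [Q hQ] := choice H.
exists Q => e e0; exists (Num.truncn e^-1) => n Nn s sM.
apply: lt_le_trans (hQ n s sM) _.
rewrite -[leRHS]invrK lef_pV2 ?posrE ?invr_gt0 ?ltr0n//.
by rewrite ltW// (lt_le_trans (truncnS_gt _))// ler_nat.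
Qed.

Local Open Scope classical_set_scope.

(** * Convolution operators supported on a coset of a finite abelian group *)

Section ComplexNorm.
Variable R : realType.
Local Notation C := R[i].
Implicit Types z w : C.

Lemma cnormE z : (cnorm z)%:C%C = `|z|.
Proof. by rewrite normc_def. Qed.

Lemma cnorm_ge0 z : 0 <= cnorm z.
Proof. exact: sqrtr_ge0. Qed.

Lemma cnormM z w : cnorm (z * w) = cnorm z * cnorm w.
Proof. by apply: complexI; rewrite rmorphM /= !cnormE normrM. Qed.

Lemma ler_cnormD z w : cnorm (z + w) <= cnorm z + cnorm w.
Proof. by rewrite -lecR rmorphD /= !cnormE ler_normD. Qed.

Lemma cnorm0 : cnorm (0 : C) = 0.
Proof. by apply: complexI; rewrite cnormE normr0. Qed.

Lemma cnorm1 : cnorm (1 : C) = 1.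
Proof. by apply: complexI; rewrite cnormE normr1. Qed.

Lemma cnormN z : cnorm (- z) = cnorm z.
Proof. by apply: complexI; rewrite !cnormE normrN. Qed.

Lemma cnormR (x : R) : cnorm x%:C%C = `|x|.
Proof. by rewrite /cnorm /= expr0n addr0 sqrtr_sqr. Qed.

Lemma cnorm_conj z : cnorm z^*%C = cnorm z.
Proof. by case: z => a b; rewrite /cnorm /= sqrrN. Qed.

Lemma cnorm_sum (I : Type) (r : seq I) (Q : pred I) (E : I -> C) :
  cnorm (\sum_(i <- r | Q i) E i) <= \sum_(i <- r | Q i) cnorm (E i).
Proof.
elim: r => [|i r IH]; first by rewrite !big_nil cnorm0.
by rewrite !big_cons; case: ifP => // _; rewrite (le_trans (ler_cnormD _ _))// lerD2l.
Qed.

Lemma cnorm2E z : (cnorm z ^+ 2)%:C%C = z * z^*%C.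
Proof.
case: z => a b; rewrite /cnorm sqr_sqrtr ?addr_ge0 ?sqr_ge0//.
by apply/eqP; rewrite eq_complex /=; apply/andP; split; apply/eqP; ring.
Qed.

End ComplexNorm.

(** * Finitely supported sums *)

Section FiniteSupport.
Variable T : choiceType.
Implicit Type V : idomainType.

Definition fsupp (V : nmodType) (f : T -> V) := exists X : {fset T}, forall g, g \notin X -> f g = 0.

Lemma fsuppP V (f : T -> V) : finite_set [set g | f g != 0] -> fsupp f.
Proof.
move=> fin; exists (fset_set [set g | f g != 0]) => g.
move=> gX; apply/eqP/negPn/negP => fg; move/negP: gX; apply.
by rewrite in_fset_set//; apply: mem_set.
Qed.

Lemma fsuppM2 (V V' W : nmodType) (f : T -> V) (f' : T -> V') (h : T -> W) :
  (forall g, f g = 0 -> f' g = 0 -> h g = 0) -> fsupp f -> fsupp f' -> fsupp h.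
Proof.
move=> H [X hX] [Y hY]; exists (X `|` Y)%fset => g; rewrite in_fsetU negb_or => /andP[gX gY].
by apply: H; [exact: hX|exact: hY].
Qed.

Lemma fsupp1 (V W : nmodType) (f : T -> V) (h : T -> W) :
  (forall g, f g = 0 -> h g = 0) -> fsupp f -> fsupp h.
Proof. by move=> H ff; apply: (fsuppM2 _ ff ff) => g fg _; exact: H. Qed.

Lemma fsupp_bij (V : nmodType) (f : T -> V) (s s' : T -> T) : cancel s s' -> cancel s' s ->
  fsupp f -> fsupp (f \o s).
Proof.
move=> sK sK' [X hX]; exists [fset s' x | x in X]%fset => g gX; apply: hX.
by apply: contra gX => h; apply/imfsetP; exists (s g).
Qed.

Lemma fsumD V (f f' : T -> V) : fsupp f -> fsupp f' ->
  \sum_(g \in [set: T]) (f g + f' g) = \sum_(g \in [set: T]) f g + \sum_(g \in [set: T]) f' g.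
Proof.
move=> [X hX] [Y hY]; pose Z := (X `|` Y)%fset.
have hZ g : g \notin Z -> f g = 0 /\ f' g = 0.
  by rewrite in_fsetU negb_or => /andP[/hX -> /hY ->].
rewrite !(@fsbigTE _ _ _ _ Z) ?big_split// => g /hZ[h h'] //.
by rewrite h h' addr0.
Qed.

Lemma fsupp_sum (V : nmodType) (I : finType) (f : I -> T -> V) :
  (forall i, fsupp (f i)) -> fsupp (fun g => \sum_i f i g).
Proof.
move=> /choice[X hX]; exists [fset x in flatten [seq enum_fset (X i) | i <- enum I]]%fset => g gZ.
rewrite big1// => i _; apply: hX; apply: contra gZ => gX.
by rewrite inE /=; apply/flatten_mapP; exists i => //; exact: mem_enum.
Qed.

Lemma fsum_sum V (I : finType) (f : I -> T -> V) : (forall i, fsupp (f i)) ->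
  \sum_(g \in [set: T]) (\sum_i f i g) = \sum_i \sum_(g \in [set: T]) f i g.
Proof.
move=> /choice[X hX]; pose Z := [fset x in flatten [seq enum_fset (X i) | i <- enum I]]%fset.
have hZ g : g \notin Z -> forall i, f i g = 0.
  move=> gZ i; apply: hX; apply: contra gZ => gX.
  rewrite inE /=; apply/flatten_mapP; exists i => //; exact: mem_enum.
rewrite (@fsbigTE _ _ _ _ Z); last by move=> g /hZ h; rewrite big1.
rewrite exchange_big; apply: eq_bigr => i _.
by rewrite (@fsbigTE _ _ _ _ Z)// => g /hZ.
Qed.

Lemma ler_fsum (R : realType) (f f' : T -> R) : fsupp f -> fsupp f' -> (forall g, f g <= f' g) ->
  \sum_(g \in [set: T]) f g <= \sum_(g \in [set: T]) f' g.
Proof.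
move=> [X hX] [Y hY] le; pose Z := (X `|` Y)%fset.
rewrite !(@fsbigTE _ _ _ _ Z) ?ler_sum// => g; rewrite in_fsetU negb_or => /andP[].
  by move=> _ /hY.
by move=> /hX.
Qed.

Lemma cnorm_fsum (R : realType) (f : T -> R[i]) : fsupp f ->
  cnorm (\sum_(g \in [set: T]) f g) <= \sum_(g \in [set: T]) cnorm (f g).
Proof.
move=> [X hX]; rewrite !(@fsbigTE _ _ _ _ X)//; first exact: cnorm_sum.
by move=> g /hX ->; rewrite cnorm0.
Qed.

Lemma fsum_real_complex (R : realType) (f : T -> R) : fsupp f ->
  (\sum_(g \in [set: T]) f g)%:C%C = \sum_(g \in [set: T]) (f g)%:C%C.
Proof.
move=> [X hX]; rewrite !(@fsbigTE _ _ _ _ X) ?rmorph_sum//.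
by move=> g /hX ->; rewrite rmorph0.
Qed.

Lemma fsum_inj V (I : finType) (h : I -> T) (f : T -> V) : injective h ->
  (forall g, f g != 0 -> exists i, g = h i) ->
  \sum_(g \in [set: T]) f g = \sum_i f (h i).
Proof.
move=> hinj hf; rewrite (fsbigE (map h (enum I))) //; last 2 first.
- by rewrite map_inj_uniq ?enum_uniq.
- by move=> g _; apply: contraNeq => /hf[i ->]; apply: map_f; rewrite mem_enum.
rewrite big_map big_enum_cond /=; apply: eq_bigl => i; exact: in_setT.
Qed.

End FiniteSupport.

(** * Functions on an abelian subgroup and on its coset *)

Section Coset.
Variables (R : realType) (F : finFieldType) (W : finZmodType).
Local Notation G := (Sp4 F).
Local Notation C := R[i].
Variables (kap : W -> G) (g0 : G).
Hypothesis kapD : forall x y, kap (x + y) = mulG (kap x) (kap y).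
Hypothesis kap_inj : injective kap.
Implicit Types (x y z : W) (p X Y : W -> C) (xi : G -> C) (g : G).

Definition coset_pt x := mulG g0 (kap x).

Lemma kap0 : kap 0 = oneG F.
Proof. by rewrite -[LHS](mulKG (kap 0)) -kapD addr0 mulVG. Qed.

Lemma kapN x : kap (- x) = invG (kap x).
Proof. by rewrite -[LHS](mulKG (kap x)) -kapD addrN kap0 mulG1. Qed.

Lemma coset_pt_inj : injective coset_pt.
Proof. by move=> x y /(congr1 (mulG (invG g0))); rewrite !mulKG => /kap_inj. Qed.

(** For [x] supported on the coset, this puts [x^* x] in the group algebra of the abelian
    subgroup. *)
Lemma coset_ptV x y : mulG (invG (coset_pt x)) (coset_pt y) = kap (y - x).
Proof. by rewrite /coset_pt invMG -mulGA mulKG -kapN -kapD addrC. Qed.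

Definition extend (h : W -> G) X : G -> C := fun g => \sum_x (if g == h x then X x else 0).

Lemma extendE (h : W -> G) X x : injective h -> extend h X (h x) = X x.
Proof.
move=> hinj; rewrite /extend (bigD1 x)//= eqxx big1 ?addr0// => y yx.
by rewrite (inj_eq hinj) eq_sym (negbTE yx).
Qed.

Lemma extend_neq0 (h : W -> G) X g : extend h X g != 0 -> exists x, g = h x.
Proof.
apply: contra_neqP => H; rewrite /extend big1// => x _; case: eqP => // e.
by exfalso; apply: H; exists x.
Qed.

Lemma extend_out (h : W -> G) X g : (forall x, g <> h x) -> extend h X g = 0.
Proof. by move=> H; apply/eqP; apply/negPn/negP => /extend_neq0[x /H]. Qed.

Lemma extend_fin_supp (h : W -> G) X : fin_supp (extend h X).
Proof.
apply: (@sub_finite_set _ _ [set` map h (enum W)]).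
  by move=> g /extend_neq0[x ->] /=; apply: map_f; rewrite mem_enum.
exact: finite_seq.
Qed.

Lemma eq_extend (h : W -> G) (f : G -> C) : injective h -> (forall g, f g != 0 -> exists x, g = h x) ->
  f = extend h (f \o h).
Proof.
move=> hinj H; apply/funext => g; have [[x ->]|nx] := pselect (exists x, g = h x).
  by rewrite extendE.
rewrite extend_out; last by move=> x e; apply: nx; exists x.
by apply/eqP/negPn/negP => /H.
Qed.

Lemma lambda_extend p xi g : lambda (extend coset_pt p) xi g = \sum_x p x * xi (mulG (invG (coset_pt x)) g).
Proof.
rewrite /lambda (fsum_inj coset_pt_inj).
  by apply: eq_bigr => x _; rewrite extendE//; exact: coset_pt_inj.
by move=> h; rewrite mulf_eq0 negb_or => /andP[/extend_neq0].
Qed.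

Lemma lambda_adj_extend p xi g :
  lambda (adjf (extend coset_pt p)) xi g = \sum_x (p x)^*%C * xi (mulG (coset_pt x) g).
Proof.
rewrite /lambda (@fsum_inj _ _ _ (fun x => invG (coset_pt x))).
- apply: eq_bigr => x _; rewrite /adjf invGK extendE//; exact: coset_pt_inj.
- by move=> x y /(congr1 (@invG F)); rewrite !invGK => /coset_pt_inj.
move=> h; rewrite mulf_eq0 negb_or => /andP[+ _].
by rewrite /adjf conjc_eq0 => /extend_neq0[x e]; exists x; rewrite -e invGK.
Qed.

(** The operator maps functions on the subgroup to functions on the coset, and its adjoint maps back
    ([lambda_adj_extend_cst]); all moments are thus computed in the finite-dimensional space
    l^2(W). *)
Lemma lambda_extend_kap p X :
  lambda (extend coset_pt p) (extend kap X) = extend coset_pt (fun x => \sum_y p (x - y) * X y).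
Proof.
apply/funext => g; rewrite lambda_extend; have [[x ->]|nx] := pselect (exists x, g = coset_pt x).
  rewrite extendE; last exact: coset_pt_inj.
  rewrite (reindex_inj (subrI x)); apply: eq_bigr => y _ /=.
  by rewrite coset_ptV extendE// subKr.
rewrite [RHS]extend_out; last by move=> x e; apply: nx; exists x.
rewrite big1// => x _; rewrite extend_out ?mulr0// => y e; apply: nx; exists (x + y).
by rewrite /coset_pt kapD mulGA -/(coset_pt x) -e mulKVG.
Qed.

Lemma lambda_adj_extend_cst p Y :
  lambda (adjf (extend coset_pt p)) (extend coset_pt Y) = extend kap (fun x => \sum_z (p z)^*%C * Y (z + x)).
Proof.
apply/funext => g; rewrite lambda_adj_extend; have [[x ->]|nx] := pselect (exists x, g = kap x).
  rewrite extendE//; apply: eq_bigr => y _.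
  by rewrite /coset_pt -mulGA -kapD -/(coset_pt (y + x)) extendE//; exact: coset_pt_inj.
rewrite [RHS]extend_out; last by move=> x e; apply: nx; exists x.
rewrite big1// => x _; rewrite extend_out ?mulr0// => y e; apply: nx; exists (y - x).
by rewrite -coset_ptV -e mulKG.
Qed.

Lemma delta1_extend : @delta1 R F = extend kap (fun x => if x == 0 then 1 else 0).
Proof.
rewrite [LHS](eq_extend kap_inj).
  by congr extend; apply/funext => x; rewrite /delta1 /= -kap0 (inj_eq kap_inj).
move=> g; rewrite /delta1; case: (g =P oneG F) => [-> _|_]; first by exists 0; rewrite kap0.
by rewrite eqxx.
Qed.

Lemma l2norm_ge0 xi : 0 <= l2norm xi. Proof. exact: sqrtr_ge0. Qed.

Lemma l2norm_sqr xi : l2norm xi ^+ 2 = \sum_(g \in [set: G]) (cnorm (xi g)) ^+ 2.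
Proof. by rewrite sqr_sqrtr// fsumr_ge0// => g _; rewrite sqr_ge0. Qed.

Lemma l2norm_extend (h : W -> G) X : injective h -> l2norm (extend h X) ^+ 2 = \sum_x cnorm (X x) ^+ 2.
Proof.
move=> hinj; rewrite l2norm_sqr (fsum_inj hinj).
  by apply: eq_bigr => x _; rewrite extendE.
move=> g; rewrite sqrf_eq0 => H; apply: (@extend_neq0 h X); apply: contra H => /eqP ->.
by rewrite cnorm0.
Qed.

(* The correlation [cor k = sum_g xi(k g) conj(xi g)] is a coefficient of the regular
   representation; only its bound matters. *)
Lemma l2norm_lambda_extend xi : fin_supp xi -> exists cor : G -> C,
  (forall k, cnorm (cor k) <= l2norm xi ^+ 2) /\
  forall p, ((l2norm (lambda (extend coset_pt p) xi)) ^+ 2)%:C%C =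
    \sum_x \sum_y p x * (p y)^*%C * cor (kap (y - x)).
Proof.
move=> /fsuppP fxi.
have mulb k : bijective (mulG k : G -> G).
  by exists (mulG (invG k)) => g; rewrite ?mulKG ?mulKVG.
have fxik k : fsupp (xi \o mulG k).
  by apply: (fsupp_bij (s' := mulG (invG k))) fxi => g; rewrite ?mulKG ?mulKVG.
exists (fun k => \sum_(g \in [set: G]) xi (mulG k g) * (xi g)^*%C); split=> [k|p].
  have fk : fsupp (fun g => xi (mulG k g) * (xi g)^*%C).
    by apply: fsuppM2 (fxik k) fxi => g /= -> _; rewrite mul0r.
  apply: le_trans (cnorm_fsum fk) _.
  have fk2 : fsupp (fun g => 2^-1 * cnorm (xi (mulG k g)) ^+ 2).
    by apply: fsupp1 (fxik k) => g /= ->; rewrite cnorm0 expr0n mulr0.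
  have f2 : fsupp (fun g => 2^-1 * cnorm (xi g) ^+ 2).
    by apply: fsupp1 fxi => g ->; rewrite cnorm0 expr0n mulr0.
  (* Instead of Cauchy-Schwarz, [a b <= (a^2 + b^2) / 2] suffices, since both squares have the same
     sum by translation invariance. *)
  apply: (@le_trans _ _ (\sum_(g \in [set: G])
      (2^-1 * cnorm (xi (mulG k g)) ^+ 2 + 2^-1 * cnorm (xi g) ^+ 2))).
    apply: ler_fsum.
    - by apply: fsupp1 fk => g ->; rewrite cnorm0.
    - by apply: fsuppM2 fk2 f2 => g -> ->; rewrite addr0.
    move=> g; rewrite cnormM cnorm_conj.
    by have := sqr_ge0 (cnorm (xi (mulG k g)) - cnorm (xi g)); rewrite !expr2; lra.
  rewrite fsumD// -!mulr_fsumr l2norm_sqr.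
  by rewrite -(reindex_fsbigT (mulG k) (fun g => cnorm (xi g) ^+ 2) (mulb k)); lra.
have fl x : fsupp (fun g => p x * xi (mulG (invG (coset_pt x)) g)).
  by apply: fsupp1 (fxik (invG (coset_pt x))) => g /= ->; rewrite mulr0.
rewrite l2norm_sqr fsum_real_complex; last first.
  by apply: fsupp1 (fsupp_sum fl) => g; rewrite lambda_extend => ->; rewrite cnorm0 expr0n.
transitivity (\sum_(g \in [set: G]) \sum_x \sum_y
    p x * (p y)^*%C * (xi (mulG (invG (coset_pt x)) g) * (xi (mulG (invG (coset_pt y)) g))^*%C)).
  apply: eq_fsbigr => g _; rewrite cnorm2E lambda_extend rmorph_sum /= big_distrl /=.
  apply: eq_bigr => x _; rewrite big_distrr /=; apply: eq_bigr => y _.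
  by rewrite rmorphM /=; ring.
have fxy x y : fsupp (fun g => p x * (p y)^*%C *
    (xi (mulG (invG (coset_pt x)) g) * (xi (mulG (invG (coset_pt y)) g))^*%C)).
  by apply: fsupp1 (fxik (invG (coset_pt x))) => g /= ->; rewrite mul0r mulr0.
rewrite fsum_sum; last by move=> x; exact: fsupp_sum (fxy x).
apply: eq_bigr => x _; rewrite fsum_sum//; apply: eq_bigr => y _.
rewrite -mulr_fsumr; congr (_ * _); rewrite (reindex_fsbigT _ _ (mulb (coset_pt y))).
by apply: eq_fsbigr => g _; rewrite mulKG mulGA coset_ptV.
Qed.

End Coset.

(** * Reduced norms of operators supported on the coset *)

Section CosetNorms.
Variables (R : realType) (F : finFieldType) (W : finZmodType).
Local Notation G := (Sp4 F).
Local Notation C := R[i].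
Variables (kap : W -> G) (g0 : G).
Hypothesis kapD : forall x y, kap (x + y) = mulG (kap x) (kap y).
Hypothesis kap_inj : injective kap.
Implicit Types (x y z : W) (p X Y : W -> C) (xi : G -> C) (g : G).
Local Notation coset_pt := (coset_pt kap g0).
Local Notation op p := (extend coset_pt p).

(** This crude l^1 bound makes the set in [cstar_norm] bounded above, so that [sup] is a true
    supremum. *)
Lemma l2norm_lambda_le p xi : fin_supp xi ->
  l2norm (lambda (op p) xi) ^+ 2 <= (\sum_x cnorm (p x)) ^+ 2 * l2norm xi ^+ 2.
Proof.
move=> fxi; have [cor [hc H]] := l2norm_lambda_extend g0 kapD kap_inj fxi.
have -> : l2norm (lambda (op p) xi) ^+ 2 = cnorm ((l2norm (lambda (op p) xi) ^+ 2)%:C%C : C).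
  by rewrite cnormR ger0_norm// sqr_ge0.
rewrite H; apply: le_trans (cnorm_sum _ _ _) _.
rewrite expr2 -mulrA big_distrl /=; apply: ler_sum => x _.
rewrite mulr_suml mulr_sumr; apply: le_trans (cnorm_sum _ _ _) _; apply: ler_sum => y _.
rewrite !cnormM cnorm_conj mulrA ler_wpM2l// mulr_ge0//; exact: cnorm_ge0.
Qed.

Lemma cstar_norm_ge p xi : fin_supp xi -> l2norm xi <= 1 ->
  l2norm (lambda (op p) xi) <= cstar_norm (op p).
Proof.
move=> fxi xi1; apply: ub_le_sup; last by exists xi.
exists (\sum_x cnorm (p x)) => _ [eta [feta eta1] <-].
rewrite -(@ler_pXn2r _ 2)// ?nnegrE ?l2norm_ge0 ?sumr_ge0//; last by move=> *; exact: cnorm_ge0.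
apply: le_trans (l2norm_lambda_le p feta) _.
by rewrite ler_piMr ?sqr_ge0// exprn_ile1 ?l2norm_ge0.
Qed.

Lemma cstar_norm_ge0 p : 0 <= cstar_norm (op p).
Proof.
have l0 : l2norm ((fun=> 0) : G -> C) = 0.
  by rewrite /l2norm fsbig1 ?sqrtr0// => g _; rewrite cnorm0 expr0n.
apply: le_trans (l2norm_ge0 (lambda (op p) (fun=> 0))) _; apply: cstar_norm_ge.
  by rewrite /fin_supp (_ : [set _ | _] = set0) // -subset0 => g /=; rewrite eqxx.
by rewrite l0.
Qed.

Lemma cstar_norm_le p B : 0 <= B -> (forall xi, fin_supp xi -> l2norm xi <= 1 ->
  l2norm (lambda (op p) xi) ^+ 2 <= B ^+ 2) -> cstar_norm (op p) <= B.
Proof.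
move=> B0 H; apply: ge_sup.
  exists (l2norm (lambda (op p) (fun=> 0))); exists (fun=> 0) => //; split.
    by rewrite /fin_supp (_ : [set _ | _] = set0) // -subset0 => g /=; rewrite eqxx.
  by rewrite /l2norm fsbig1 ?sqrtr0// => g _; rewrite cnorm0 expr0n.
move=> _ [eta [feta eta1] <-].
by rewrite -(@ler_pXn2r _ 2)// ?nnegrE ?l2norm_ge0// H.
Qed.

(** The test vector is the normalised constant function on the subgroup, which carries the trivial
    representation. *)
Lemma cstar_norm_sum p : cnorm (\sum_x p x) <= cstar_norm (op p).
Proof.
pose N : R := #|W|%:R.
have N0 : 0 < N by rewrite ltr0n; apply/card_gt0P; exists 0.
pose X : W -> C := fun=> (Num.sqrt N^-1)%:C%C.
have cX x : cnorm (X x) ^+ 2 = N^-1.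
  by rewrite /X cnormR ger0_norm ?sqrtr_ge0// sqr_sqrtr// invr_ge0 ltW.
have X1 : l2norm (extend kap X) <= 1.
  rewrite -(@ler_pXn2r _ 2)// ?nnegrE ?l2norm_ge0// l2norm_extend//.
  by under eq_bigr do rewrite cX; rewrite sumr_const -mulr_natl mulfV ?gt_eqF// expr1n.
apply: le_trans (cstar_norm_ge p (extend_fin_supp kap X) X1).
rewrite -(@ler_pXn2r _ 2)// ?nnegrE ?l2norm_ge0 ?cnorm_ge0//.
rewrite lambda_extend_kap// l2norm_extend; last exact: coset_pt_inj.
have E x : cnorm (\sum_y p (x - y) * X y) ^+ 2 = cnorm (\sum_x p x) ^+ 2 * N^-1.
  rewrite -(cX x) -exprMn -cnormM; congr (cnorm _ ^+ 2).
  rewrite mulr_suml (reindex_inj (subrI x)) /=.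
  by apply: eq_bigr => y _; rewrite subKr.
rewrite (eq_bigr _ (fun x _ => E x)) sumr_const -[leRHS]mulr_natr divfK//.
by rewrite gt_eqF.
Qed.

End CosetNorms.

(** * Spectral decomposition of a Gram matrix *)

Section Spectral.
Variables (R : realType) (n : nat).
Local Notation C := R[i].
Local Open Scope sesquilinear_scope.
Implicit Types (A U : 'M[C]_n) (v : 'cV[C]_n).

Definition vnorm2 m (v : 'cV[C]_m) : R := \sum_i cnorm (v i 0) ^+ 2.

Lemma vnorm2E m (v : 'cV[C]_m) : (v^t* *m v) 0 0 = (vnorm2 v)%:C%C.
Proof.
rewrite mxE /vnorm2 rmorph_sum /=; apply: eq_bigr => i _.
by rewrite cnorm2E mulrC !mxE.
Qed.

(** Writing each eigenvalue as the squared length of the image of a unit eigenvector makes it real,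
    nonnegative and comparable with the operator norm. *)
Lemma gram_spectral A : exists (U : 'M[C]_n) (d : 'I_n -> R),
  [/\ U^t* *m U = 1%:M, A^t* *m A = U^t* *m diag_mx (\row_j (d j)%:C%C) *m U &
      forall j, d j = vnorm2 (A *m (row j U)^t*)].
Proof.
set M := A^t* *m A.
have MM : M^t* = M by rewrite /M trmx_mul map_mxM trmxCK.
have /orthomx_spectralP e : M \is normalmx by apply/normalmxP; rewrite MM.
have Uu := spectral_unitarymx M.
set U := spectralmx M in e Uu; set D := spectral_diag M in e.
have UU : U *m U^t* = 1%:M by apply/unitarymxP.
have UU' : U^t* *m U = 1%:M by apply: mulmx1C.
rewrite invmx_unitary// in e.
exists U, (fun j => vnorm2 (A *m (row j U)^t*)); split => //.
rewrite {1}e; congr (_ *m diag_mx _ *m _); apply/rowP => j; rewrite mxE -vnorm2E.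
rewrite trmx_mul map_mxM trmxCK -mulmxA (mulmxA (A^t*)) -/M e.
have -> : row j U *m (U^t* *m diag_mx D *m U *m (row j U)^t*) = 
   row j (U *m U^t*) *m diag_mx D *m (U *m (row j U)^t*).
  by rewrite row_mul !mulmxA.
rewrite UU; have -> : U *m (row j U)^t* = col j (U *m U^t*).
  by rewrite colE -mulmxA -colE; congr (_ *m _); apply/matrixP => a b; rewrite !mxE.
rewrite UU mul_mx_diag !mxE (bigD1 j)//= !mxE eqxx mul1r mulr1 big1 ?addr0// => i ij.
by rewrite !mxE (negbTE ij) mulr0.
Qed.

Lemma spectral_iter (M U : 'M[C]_n) (D : 'rV[C]_n) v k :
  U^t* *m U = 1%:M -> M = U^t* *m diag_mx D *m U ->
  iter k (mulmx M) v = U^t* *m (\col_j (D 0 j ^+ k * (U *m v) j 0)).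
Proof.
move=> UU ME; have UU' := mulmx1C UU; elim: k => [|k IH] /=.
  rewrite -[LHS]mul1mx -UU -mulmxA; congr (_ *m _); apply/matrixP => i j.
  by rewrite !mxE expr0 mul1r; congr (\sum__ _ * v _ _); rewrite ord1.
rewrite IH ME -!mulmxA (mulmxA U) UU' mul1mx; congr (_ *m _).
by apply/matrixP => i j; rewrite mul_diag_mx !mxE exprS mulrA.
Qed.

(* If v is an eigenvector of M = A^* A with eigenvalue lam, its spectral coordinates live on
   the eigenvalues equal to lam, which bounds the spectral weight of lam from below. *)
Lemma spectral_weight_eigen A U (d : 'I_n -> R) v (lam : R) i0 :
  U^t* *m U = 1%:M -> A^t* *m A = U^t* *m diag_mx (\row_j (d j)%:C%C) *m U ->
  A^t* *m A *m v = lam%:C%C *: v -> v i0 0 = 1 ->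
  1 <= vnorm2 v * \sum_(j | d j == lam) cnorm (U j i0) ^+ 2.
Proof.
move=> UU ME Mv v0; have UU' := mulmx1C UU.
pose t := U *m v.
have tN : vnorm2 t = vnorm2 v.
  apply: complexI; rewrite -!vnorm2E /t trmx_mul map_mxM mulmxA -(mulmxA _ (U^t*)) UU.
  by rewrite mulmx1.
have tj j : d j != lam -> t j 0 = 0.
  move=> dj; have : (U *m (A^t* *m A *m v)) j 0 = (lam%:C%C *: t) j 0.
    by rewrite Mv -scalemxAr.
  rewrite ME !mulmxA UU' mul1mx -mulmxA mul_diag_mx !mxE => /eqP.
  rewrite -subr_eq0 -mulrBl mulf_eq0 -rmorphB /=  => /orP[|/eqP] //.
  by move=> /eqP/complexI/eqP; rewrite subr_eq0 (negbTE dj).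
have e1 : 1 = \sum_j (U j i0)^*%C * t j 0.
  rewrite -v0 -[in LHS](mul1mx v) -UU -mulmxA mxE; apply: eq_bigr => j _.
  by rewrite !mxE.
set N := vnorm2 v in tN *.
have N0 : 0 < N.
  rewrite /N /vnorm2 (bigD1 i0)//= v0 cnorm1 expr1n ltr_pwDl//.
  by rewrite sumr_ge0// => *; rewrite sqr_ge0.
have le1 : 1 <= \sum_(j | d j == lam) cnorm (U j i0) * cnorm (t j 0).
  rewrite -(cnorm1 R) e1 (bigID (fun j => d j == lam)) /=.
  rewrite [X in _ + X]big1 ?addr0; last by move=> j /tj ->; rewrite mulr0.
  by apply: le_trans (cnorm_sum _ _ _) _; apply: ler_sum => j _; rewrite cnormM cnorm_conj.
(* Cauchy-Schwarz as a weighted mean inequality; the weight [N], the squared length of [t], makes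
   the last sum equal to 1. *)
have le2 : \sum_(j | d j == lam) cnorm (U j i0) * cnorm (t j 0) <=
    2^-1 * (N * \sum_(j | d j == lam) cnorm (U j i0) ^+ 2 +
            \sum_j N^-1 * cnorm (t j 0) ^+ 2).
  apply: (@le_trans _ _ (2^-1 * (N * \sum_(j | d j == lam) cnorm (U j i0) ^+ 2 +
      \sum_(j | d j == lam) N^-1 * cnorm (t j 0) ^+ 2))); last first.
    rewrite ler_pM2l ?invr_gt0// lerD2l [leRHS](bigID (fun j => d j == lam)) /= lerDl.
    by rewrite sumr_ge0// => j _; rewrite mulr_ge0 ?sqr_ge0// invr_ge0 ltW.
  rewrite mulr_sumr -big_split mulr_sumr /=; apply: ler_sum => j _.
  have := sqr_ge0 (N * cnorm (U j i0) - cnorm (t j 0)).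
  rewrite -(@pmulr_rge0 _ (N^-1)) ?invr_gt0// => h.
  rewrite -subr_ge0; have -> : 2^-1 * (N * cnorm (U j i0) ^+ 2 + N^-1 * cnorm (t j 0) ^+ 2) -
     cnorm (U j i0) * cnorm (t j 0) = 2^-1 * (N^-1 * (N * cnorm (U j i0) - cnorm (t j 0)) ^+ 2).
    by field; rewrite gt_eqF.
  by rewrite mulr_ge0.
rewrite -mulr_sumr -/(vnorm2 t) tN mulVf ?gt_eqF// in le2.
by have := le_trans le1 le2; lra.
Qed.
End Spectral.

(** * Spectral measure of [x^* x] at the identity *)

Section CosetSpectrum.
Variables (R : realType) (F : finFieldType) (W : finZmodType).
Local Notation G := (Sp4 F).
Local Notation C := R[i].
Variables (kap : W -> G) (g0 : G).
Hypothesis kapD : forall x y, kap (x + y) = mulG (kap x) (kap y).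
Hypothesis kap_inj : injective kap.
Implicit Types (x y z : W) (p X Y : W -> C) (xi : G -> C) (g : G).
Local Notation coset_pt := (coset_pt kap g0).
Local Notation op p := (extend coset_pt p).
Local Open Scope sesquilinear_scope.
Local Notation n := #|W|.
Local Notation ev := (@enum_val W predT).

Definition conv_mx p : 'M[C]_n := \matrix_(i, j) p (ev i - ev j).

Lemma sum_enum (V : nmodType) (E : W -> V) : \sum_x E x = \sum_(i < n) E (ev i).
Proof. by rewrite (reindex ev)//; apply: onW_bij; exact: enum_val_bij. Qed.

Lemma conv_mxE p X : lambda (op p) (extend kap X) =
  op (fun x => (conv_mx p *m (\col_i X (ev i))) (enum_rank x) 0).
Proof.
rewrite lambda_extend_kap//; congr extend; apply/funext => x.
by rewrite sum_enum mxE; apply: eq_bigr => i _; rewrite !mxE enum_rankK.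
Qed.

Lemma gram_mxE p X : lambda (adjf (op p)) (lambda (op p) (extend kap X)) =
  extend kap (fun x => ((conv_mx p)^t* *m conv_mx p *m (\col_i X (ev i))) (enum_rank x) 0).
Proof.
rewrite conv_mxE lambda_adj_extend_cst//; congr extend; apply/funext => x.
rewrite -mulmxA [RHS]mxE (reindex_inj (addIr (- x))) /=.
rewrite sum_enum; apply: eq_bigr => i _; rewrite !mxE enum_rankK subrK enum_valK.
by congr (_ * _); rewrite !mxE.
Qed.

Lemma moment_iter p k : iter k (fun xi => lambda (adjf (op p)) (lambda (op p) xi)) (@delta1 R F) =
  extend kap (fun x => iter k (mulmx ((conv_mx p)^t* *m conv_mx p)) (\col_i (ev i == 0)%:R) (enum_rank x) 0).
Proof.
elim: k => [|k IH] /=.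
  rewrite (delta1_extend R kapD kap_inj); congr extend; apply/funext => x.
  by rewrite mxE enum_rankK; case: eqP.
rewrite IH gram_mxE; congr extend; apply/funext => x; congr (fun_of_matrix (_ *m _) _ _).
by apply/matrixP => i j; rewrite mxE enum_valK ord1.
Qed.

(** The weights come from expanding the point mass at 0 in eigenvectors. The constant function has
    eigenvalue [|\sum_x p x|^2], squared length [#|W|] and value 1 at 0, so this atom has weight at
    least [1 / #|W|]. *)
Lemma spectral_measure p : exists (w d : 'I_n -> R),
  [/\ forall j, 0 <= w j, forall j, 0 <= d j <= cstar_norm (op p) ^+ 2,
      forall k, moment (op p) k = \sum_j w j * d j ^+ k &
      1 <= n%:R * \sum_(j | d j == cnorm (\sum_x p x) ^+ 2) w j].
Proof.
have [U [d [UU ME dE]]] := gram_spectral (conv_mx p).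
pose i0 := enum_rank (0 : W).
exists (fun j => cnorm (U j i0) ^+ 2), d; split.
- by move=> j; exact: sqr_ge0.
- move=> j; rewrite dE sumr_ge0//=; last by move=> *; exact: sqr_ge0.
  (* Extended by zero, the unit eigenvector becomes a test vector for the norm on all of [G]. *)
  pose X x := ((row j U)^t* (enum_rank x) 0).
  have XE : \col_i X (ev i) = (row j U)^t*.
    by apply/matrixP => a b; rewrite mxE /X enum_valK ord1.
  have X1 : l2norm (extend kap X) ^+ 2 = 1.
    rewrite l2norm_extend// sum_enum; apply: complexI; rewrite rmorph1.
    have UU' := mulmx1C UU; have : (U *m U^t*) j j = 1 by rewrite UU' mxE eqxx.
    rewrite mxE => <-; rewrite rmorph_sum /=; apply: eq_bigr => i _.
    by rewrite /X enum_valK cnorm2E mulrC !mxE /= conjcK.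
  have := cstar_norm_ge g0 kapD kap_inj p (extend_fin_supp kap X).
  rewrite -(@ler_pXn2r _ 2) ?nnegrE ?l2norm_ge0// X1 expr1n => /(_ (lexx _)).
  rewrite -(@ler_pXn2r _ 2) ?nnegrE ?l2norm_ge0 ?(cstar_norm_ge0 g0 kapD kap_inj)// => h.
  apply: le_trans h; rewrite conv_mxE XE l2norm_extend; last exact: coset_pt_inj.
  by rewrite sum_enum; apply: ler_sum => i _; rewrite enum_valK.
- move=> k; rewrite /moment moment_iter -(kap0 kapD) extendE// (spectral_iter _ _ UU ME).
  rewrite -/i0 mxE raddf_sum /=; apply: eq_bigr => j _.
  rewrite !mxE (bigD1 i0)//= !mxE enum_rankK eqxx mulr1 big1; last first.
    by move=> i ii; rewrite !mxE -(inj_eq enum_rank_inj) enum_valK (negbTE ii) mulr0.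
  rewrite addr0 mulrCA [_ * U j i0]mulrC -cnorm2E -rmorphXn /=.
  by rewrite mulr0 subr0 mulrC.
set S := \sum_x p x.
have Mv : (conv_mx p)^t* *m conv_mx p *m (\col_(i < n) 1) = (cnorm S ^+ 2)%:C%C *: (\col_(i < n) 1 : 'cV[C]_n).
  have Av : conv_mx p *m (\col_(i < n) 1) = S *: \col_(i < n) 1.
    apply/matrixP => i j; rewrite !mxE mulr1 /S (reindex_inj (subrI (ev i))) sum_enum.
    by apply: eq_bigr => k _; rewrite !mxE mulr1.
  rewrite -mulmxA Av -scalemxAr cnorm2E -scalerA; congr (_ *: _).
  apply/matrixP => i j; rewrite !mxE mulr1 /S (reindex_inj (addIr (- ev i))) sum_enum rmorph_sum.
  by apply: eq_bigr => k _; rewrite !mxE mulr1.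
have := spectral_weight_eigen UU ME Mv (i0 := i0); rewrite mxE => /(_ erefl).
rewrite /vnorm2; under eq_bigr do rewrite mxE cnorm1 expr1n.
by rewrite sumr_const card_ord.
Qed.

End CosetSpectrum.

(** * L^p norms of operators supported on the coset *)

Section CosetLp.
Variables (R : realType) (F : finFieldType) (W : finZmodType).
Local Notation G := (Sp4 F).
Local Notation C := R[i].
Variables (kap : W -> G) (g0 : G).
Hypothesis kapD : forall x y, kap (x + y) = mulG (kap x) (kap y).
Hypothesis kap_inj : injective kap.
Implicit Types (x y z : W) (p X Y : W -> C) (xi : G -> C) (g : G).
Local Notation coset_pt := (coset_pt kap g0).
Local Notation op p := (extend coset_pt p).

Lemma tau_poly_spectral p (m : nat) (w d : 'I_m -> R) (Q : {poly R}) :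
  (forall k, moment (op p) k = \sum_j w j * d j ^+ k) ->
  tau_poly (op p) Q = \sum_j w j * Q.[d j].
Proof.
move=> H; rewrite /tau_poly; under eq_bigr do rewrite H big_distrr /=.
rewrite exchange_big /=; apply: eq_bigr => j _; rewrite horner_coef big_distrr /=.
by apply: eq_bigr => k _; rewrite mulrCA.
Qed.

(** The spectral sum satisfies the condition under [xget]. It is the only such value because an
    approximating sequence exists, [s^(r / 2)] being Lipschitz for [r >= 2]. *)
Lemma tau_abs_pow_spectral (r : R) p (m : nat) (w d : 'I_m -> R) : 2 <= r ->
  (forall j, 0 <= d j <= cstar_norm (op p) ^+ 2) ->
  (forall k, moment (op p) k = \sum_j w j * d j ^+ k) ->
  tau_abs_pow r (op p) = \sum_j w j * d j `^ (r / 2).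
Proof.
move=> r2 hd H; set v := \sum_j _.
have cv Q : (forall e : R, 0 < e -> exists N : nat, forall n : nat, (N <= n)%N ->
        forall s : R, 0 <= s <= cstar_norm (op p) ^+ 2 -> `|(Q n).[s] - s `^ (r / 2)| < e) ->
    (fun n => tau_poly (op p) (Q n)) @ \oo --> v.
  move=> hQ; under eq_fun do rewrite (tau_poly_spectral _ H).
  apply: cvg_big => [|j _]; first exact: add_continuous.
  apply: cvgM; first exact: cvg_cst.
  apply/cvgrPdist_lt => e e0; have [N hN] := hQ e e0.
  by exists N => // n Nn; rewrite distrC; apply: hN.
apply: xget_unique => // y hy.
(* Adding 1 keeps the interval nondegenerate when the norm is 0. *)
have M0 : 0 < cstar_norm (op p) ^+ 2 + 1 by rewrite ltr_wpDl ?sqr_ge0.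
have r1 : 1 <= r / 2 by rewrite ler_pdivlMr// mul1r.
have [Q hQ] := powR_poly_approx r1 M0.
have hQ' : forall e : R, 0 < e -> exists N : nat, forall n : nat, (N <= n)%N ->
        forall s : R, 0 <= s <= cstar_norm (op p) ^+ 2 -> `|(Q n).[s] - s `^ (r / 2)| < e.
  move=> e e0; have [N hN] := hQ e e0; exists N => n Nn s /andP[s0 sM].
  by apply: hN; rewrite // s0 (le_trans sM)// lerDl.
exact: (cvg_unique _ (hy Q hQ') (cv Q hQ')).
Qed.

(** The spectral measure is a probability, by its moment of order 0, and its atoms lie in
    [[0, 1]]. *)
Lemma lp_norm_le1 (r : R) p : 2 <= r -> cstar_norm (op p) <= 1 -> lp_norm r (op p) <= 1.
Proof.
move=> r2 c1; have [w [d [hw hd hm _]]] := spectral_measure g0 kapD kap_inj p.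
rewrite /lp_norm (tau_abs_pow_spectral r2 hd hm).
have r0 : 0 < r by exact: lt_le_trans r2.
have w1 : \sum_j w j = 1.
  have := hm 0%N; rewrite /moment /= /delta1 eqxx /= => ->.
  by apply: eq_bigr => j _; rewrite expr0 mulr1.
have e1 : 1 `^ (r / 2) = 1 :> R by rewrite powR1.
have v0 : 0 <= \sum_j w j * d j `^ (r / 2).
  by rewrite sumr_ge0// => j _; rewrite mulr_ge0// powR_ge0.
have e2 : 1 `^ r^-1 = 1 :> R by rewrite powR1.
rewrite -[leRHS]e2 ge0_ler_powR ?nnegrE ?invr_ge0 ?(ltW r0)// -[leRHS]w1; apply: ler_sum => j _.
have /andP[d0 dc] := hd j; rewrite -[leRHS]mulr1 ler_wpM2l// -[leRHS]e1.
rewrite ge0_ler_powR ?nnegrE ?divr_ge0 ?(ltW r0)// (le_trans dc)// exprn_ile1//.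
exact: cstar_norm_ge0.
Qed.

(** Only the atom of the trivial representation is kept; its weight of at least [1 / #|W|] produces
    the factor. *)
Lemma lp_norm_ge (r : R) p : 2 <= r ->
  cnorm (\sum_x p x) <= #|W|%:R `^ r^-1 * lp_norm r (op p).
Proof.
move=> r2; have [w [d [hw hd hm]]] := spectral_measure g0 kapD kap_inj p.
set S := cnorm _ => hS; have S0 : 0 <= S by exact: cnorm_ge0.
rewrite /lp_norm (tau_abs_pow_spectral r2 hd hm).
have r0 : 0 < r by exact: lt_le_trans r2.
have v0 : 0 <= \sum_j w j * d j `^ (r / 2).
  by rewrite sumr_ge0// => j _; rewrite mulr_ge0// powR_ge0.
rewrite -powRM//.
have SE : S = (S `^ r) `^ r^-1 by rewrite -powRrM mulfV ?gt_eqF// powRr1.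
rewrite {1}SE ge0_ler_powR ?nnegrE ?powR_ge0 ?mulr_ge0 ?invr_ge0 ?(ltW r0)//.
have Sr : S `^ r = (S ^+ 2) `^ (r / 2).
  by rewrite -powR_mulrn// -powRrM mulrCA mulfV ?mulr1// pnatr_eq0.
rewrite Sr -[leLHS]mul1r; apply: (@le_trans _ _
  (#|W|%:R * (\sum_(j | d j == S ^+ 2) w j) * (S ^+ 2) `^ (r / 2))).
  by rewrite ler_wpM2r// powR_ge0.
rewrite -mulrA ler_wpM2l// mulr_suml [leRHS](bigID (fun j => d j == S ^+ 2)) /=.
rewrite (eq_bigr (fun j => w j * d j `^ (r / 2))); last by move=> j /eqP ->.
by rewrite lerDl sumr_ge0// => j _; rewrite mulr_ge0// powR_ge0.
Qed.

Lemma pt_mul_extend (f : G -> C) p : pt_mul f (op p) = op (fun x => f (coset_pt x) * p x).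
Proof.
have ci : injective coset_pt by exact: coset_pt_inj.
 rewrite [LHS](eq_extend ci).
  by congr extend; apply/funext => x; rewrite /pt_mul /= extendE.
by move=> g; rewrite mulf_eq0 negb_or => /andP[_ /extend_neq0].
Qed.

End CosetLp.

(** * The parabola inside the Siegel unipotent radical *)

(** The name lets the finite and the additive structure of the product join into a [finZmodType] of
    increments [(a, c)]. *)
Definition plane (F : finFieldType) (n : nat) := ('rV[F]_n * 'rV[F]_n)%type.
HB.instance Definition _ F n := Finite.on (plane F n).
HB.instance Definition _ F n := GRing.Zmodule.on (plane F n).

Section Paraboloid.
Variables (R : realType) (F : finFieldType) (n : nat).
Hypothesis F2 : (2 : F) != 0.
Hypothesis n0 : (0 < n)%N.
Local Notation G := (Sp4 F).
Local Notation C := R[i].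
Local Notation V := 'rV[F]_n.+1.
Local Notation W := (plane F n.+1 : finZmodType).
Local Notation q := (#|F|%:R : R).
Implicit Types (a b c u : V) (x y : plane F n.+1).

Definition parab_hom (x : W) : G := uG (rVpoly x.1) 0 (rVpoly x.2).
Definition parab_base : G := uG 0 'X^n 0.

Lemma parab_homD x y : parab_hom (x + y) = mulG (parab_hom x) (parab_hom y).
Proof. by rewrite /parab_hom uGM !linearD /= addr0. Qed.

Lemma parab_hom_inj : injective parab_hom.
Proof.
by move=> [a c] [a' c'] /uG_inj[/= ea _ ec]; rewrite -[a]rVpolyK ea -[c]rVpolyK ec !rVpolyK.
Qed.

Lemma coset_ptE x : coset_pt parab_hom parab_base x = uG (rVpoly x.1) 'X^n (rVpoly x.2).
Proof. by rewrite /coset_pt /parab_hom uGM !add0r addr0. Qed.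

Definition parab a : V := poly_rV (rVpoly a ^+ 2 %/ 'X^n).
Definition rV_X : V := poly_rV 'X.

Lemma size_rV a : (size (rVpoly a) <= n.+1)%N.
Proof. exact: size_poly. Qed.

Lemma rVpoly_parab a : rVpoly (parab a) = rVpoly a ^+ 2 %/ 'X^n.
Proof.
rewrite poly_rV_K// size_divp ?expf_neq0 ?polyX_eq0// size_polyXn /=.
have := size_polyMleq (rVpoly a) (rVpoly a); rewrite -expr2 => h.
apply: (leq_trans (leq_sub2r n h)).
by have := size_rV a; move: (size _) => s; lia.
Qed.

Lemma rVpoly_rV_X : rVpoly rV_X = 'X.
Proof. by rewrite poly_rV_K// size_polyX. Qed.

Lemma ell_coset a c :
  ell R (uG (rVpoly a) 'X^n (rVpoly c)) = (maxn n.+1 (size (rVpoly a ^+ 2 - 'X^n * rVpoly c)))%:R.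
Proof.
rewrite /ell; case: eqP => [|_].
  rewrite -uG0 => /uG_inj[_ /eqP]; by rewrite expf_eq0 polyX_eq0 n0.
by rewrite /= (@hgt_siegel _ _ _ _ n.+1)// ?size_polyXn// size_rV.
Qed.

(* For fixed u of positive degree, this invariance in a cancels the increment u in nu^* nu. *)
Lemma parab_shift u : (1 < size (rVpoly u))%N -> exists b, forall a,
  parab (a + b + u) - parab (a + b) = parab (a + u) - parab a + rV_X.
Proof.
move=> su; pose u2 := 2%:P * rVpoly u.
have su2 : size u2 = size (rVpoly u) by rewrite /u2 mul_polyC size_scale.
have u20 : u2 != 0 by rewrite -size_poly_gt0 su2; lia.
have sb : (size ('X^(n.+1) %/ u2)%R <= n.+1)%N.
  by rewrite size_divp// size_polyXn su2; lia.
exists (poly_rV ('X^(n.+1) %/ u2)) => a.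
apply: (can_inj rVpolyK); rewrite !(linearB, linearD) /= !rVpoly_parab rVpoly_rV_X !linearD /= poly_rV_K//.
set b := 'X^(n.+1) %/ u2; set A := rVpoly a; set U := rVpoly u.
have E : (b * u2) %/ 'X^n = 'X.
  have rs : (size ('X^(n.+1) %% u2)%R < size ('X^n : {poly F})%R)%N.
    rewrite size_polyXn; apply: leq_trans (size_rV u); by rewrite -su2 ltn_modp.
  have -> : b * u2 = 'X * 'X^n - 'X^(n.+1) %% u2.
    by rewrite -exprS {1}(divp_eq 'X^(n.+1) u2) addrK.
  by rewrite divpD divpN mulpK ?expf_neq0 ?polyX_eq0// divp_small// oppr0 addr0.
move: ('X^n) E => D <-; rewrite -!divpN -!divpD; congr (_ %/ _).
by rewrite /u2 -/U polyC_natr; ring.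
Qed.

(** Its inverse square [4 q^(n+2)] counts, in [nu^* nu], four signed pairs for each of the [q^(n+1)]
    values of [a] and at most [q] constant increments [u]. *)
Definition norm_coef : R := (2 * Num.sqrt (q ^+ n.+2))^-1.

Definition parab_diff x : C := (x.2 == parab x.1)%:R - (x.2 == parab x.1 + rV_X)%:R.
Definition parab_test (x : W) : C := norm_coef%:C%C * parab_diff x.

Lemma q_gt1 : 1 < q.
Proof. by rewrite ltr1n card_finNzRing_gt1. Qed.

Lemma norm_coef_gt0 : 0 < norm_coef.
Proof. by rewrite invr_gt0 mulr_gt0// sqrtr_gt0 exprn_gt0// (lt_trans _ q_gt1). Qed.

Lemma norm_coef_sqr : norm_coef ^+ 2 * (4 * q ^+ n.+2) = 1.
Proof.
have q0 : 0 < q ^+ n.+2 by rewrite exprn_gt0// (lt_trans _ q_gt1).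
have E : (2 * Num.sqrt (q ^+ n.+2)) ^+ 2 = 4 * q ^+ n.+2.
  by rewrite exprMn sqr_sqrtr ?(ltW q0)//; ring.
by rewrite /norm_coef exprVn E mulVf// mulf_neq0 ?(gt_eqF q0).
Qed.

Lemma sum_parab_diff (E : plane F n.+1 -> C) :
  \sum_(x : plane F n.+1) E x * parab_diff x = \sum_a (E (a, parab a) - E (a, parab a + rV_X)).
Proof.
have S (D : V -> C) s : \sum_c D c * (c == s)%:R = D s.
  by rewrite (bigD1 s)//= eqxx mulr1 big1 ?addr0// => c cs; rewrite (negbTE cs) mulr0.
transitivity (\sum_a \sum_c E (a, c) * parab_diff (a, c)).
  by rewrite pair_bigA; apply: eq_bigr => -[a c].
apply: eq_bigr => a _; under eq_bigr do rewrite /parab_diff /= mulrBr.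
by rewrite sumrB (S (fun c => E (a, c))) (S (fun c => E (a, c))).
Qed.

Lemma parab_diff_conj x : (parab_diff x)^*%C = parab_diff x.
Proof. by rewrite /parab_diff rmorphB /= !rmorph_nat. Qed.

Lemma parab_test_conj x : (parab_test x)^*%C = parab_test x.
Proof. by rewrite /parab_test rmorphM; congr (_ * _); [exact: conjc_real|exact: parab_diff_conj]. Qed.

Lemma card_small_rV : (#|[set u : V | (size (rVpoly u) <= 1)%N]%SET| <= #|F|)%N.
Proof.
rewrite -(@card_in_imset _ _ (fun u : V => (rVpoly u)`_0)) ?max_card// => u v.
rewrite !inE => su sv e; apply: (can_inj rVpolyK).
by rewrite (size1_polyC su) (size1_polyC sv) e.
Qed.

Lemma parab_test_quadratic (cor : G -> C) B : (forall k, cnorm (cor k) <= B) ->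
  cnorm (\sum_x \sum_y parab_test x * (parab_test y)^*%C * cor (parab_hom (y - x))) <= B.
Proof.
move=> hB; have B0 : 0 <= B by apply: le_trans (hB (oneG F)); exact: cnorm_ge0.
pose H (u v : V) := cor (parab_hom ((u, v) : plane F n.+1)).
(* The four signed pairs of point masses over [a] and [a + u]; the two pairs of equal sign have the
   same difference, hence the factor 2. *)
pose D u a := 2 * H u (parab (a + u) - parab a) - H u (parab (a + u) - parab a + rV_X)
   - H u (parab (a + u) - parab a - rV_X).
have -> : \sum_x \sum_y parab_test x * (parab_test y)^*%C * cor (parab_hom (y - x)) =
    (norm_coef ^+ 2)%:C%C * \sum_u \sum_a D u a.
  transitivity ((norm_coef ^+ 2)%:C%C * \sum_(x : plane F n.+1) (\sum_(y : plane F n.+1) cor (parab_hom (y - x)) * parab_diff y) * parab_diff x).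
    rewrite mulr_sumr; apply: eq_bigr => x _; rewrite mulr_suml mulr_sumr.
    apply: eq_bigr => y _; rewrite parab_test_conj /parab_test rmorphXn /=; ring.
  congr (_ * _); rewrite sum_parab_diff; under eq_bigr do rewrite !sum_parab_diff -sumrB.
  rewrite [RHS]exchange_big; apply: eq_bigr => a _ /=.
  rewrite (reindex_inj (addrI a)); apply: eq_bigr => u _ /=.
  have K v w : cor (parab_hom (((a + u, v) : plane F n.+1) - (a, w))) = H u (v - w).
    by rewrite /H; congr (cor (parab_hom _)); apply: injective_projections; rewrite //= addrAC subrr add0r.
  rewrite !K /D (_ : parab (a + u) - (parab a + rV_X) = parab (a + u) - parab a - rV_X) ?opprD ?addrA//.
  rewrite (_ : parab (a + u) + rV_X - parab a - rV_X = parab (a + u) - parab a); last by rewrite addrAC addrK.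
  by rewrite (addrAC _ rV_X); ring.
(* Translating [a] by [b] shifts the increment by [rV_X], so the three sums agree and cancel with
   coefficients 2, -1, -1. *)
have D0 u : (1 < size (rVpoly u))%N -> \sum_a D u a = 0.
  move=> /parab_shift[b hb]; pose d a := parab (a + u) - parab a.
  have db a : d (a + b) = d a + rV_X by rewrite /d -hb.
  have e1 : \sum_a H u (d a + rV_X) = \sum_a H u (d a).
    by rewrite [RHS](reindex_inj (addIr b)); apply: eq_bigr => a _; rewrite /= db.
  have e2 : \sum_a H u (d a - rV_X) = \sum_a H u (d a).
    by rewrite [LHS](reindex_inj (addIr b)); apply: eq_bigr => a _; rewrite /= db addrK.
  by rewrite /D !sumrB -mulr_sumr e1 e2; ring.
rewrite (bigID (fun u => size (rVpoly u) <= 1)%N) /= [X in _ + X]big1 ?addr0; last first.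
  by move=> u; rewrite -ltnNge => /D0.
rewrite cnormM cnormR ger0_norm ?sqr_ge0// -ler_pdivlMl ?exprn_gt0 ?norm_coef_gt0//.
have cfV : (norm_coef ^+ 2)^-1 = 4 * q ^+ n.+2.
  have c0 : norm_coef ^+ 2 != 0 by rewrite expf_neq0// gt_eqF ?norm_coef_gt0.
  by apply: (mulfI c0); rewrite mulfV// norm_coef_sqr.
rewrite cfV; apply: le_trans (cnorm_sum _ _ _) _.
have DB u a : cnorm (D u a) <= 4 * B.
  rewrite /D; apply: le_trans (ler_cnormD _ _) _; rewrite cnormN.
  have := ler_cnormD (2 * H u (parab (a + u) - parab a)) (- H u (parab (a + u) - parab a + rV_X)).
  rewrite cnormN cnormM; have -> : cnorm (2 : C) = 2.
    by rewrite -[2]/(1 + 1) -(rmorph1 (real_complex R)) -rmorphD cnormR ger0_norm// addr_ge0.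
  have := hB (parab_hom ((u, parab (a + u) - parab a) : plane F n.+1)).
  have := hB (parab_hom ((u, parab (a + u) - parab a + rV_X) : plane F n.+1)).
  have := hB (parab_hom ((u, parab (a + u) - parab a - rV_X) : plane F n.+1)).
  rewrite -/(H _ _) -/(H _ _) -/(H _ _); lra.
apply: (@le_trans _ _ (\sum_(u : V | (size (rVpoly u) <= 1)%N) (q ^+ n.+1 * (4 * B)))).
  apply: ler_sum => u _; apply: le_trans (cnorm_sum _ _ _) _.
  apply: le_trans (ler_sum _ (fun a _ => DB u a)) _.
  by rewrite sumr_const card_mx mul1n -natrX -[leLHS]mulr_natl.
rewrite sumr_const -[leLHS]mulr_natl.
have -> : 4 * q ^+ n.+2 * B = q * (q ^+ n.+1 * (4 * B)) by rewrite exprS; ring.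
rewrite ler_wpM2r ?mulr_ge0 ?exprn_ge0 ?ler0n// ler_nat.
by apply: leq_trans card_small_rV; rewrite cardsE.
Qed.

Lemma cstar_parab_test : cstar_norm (extend (coset_pt parab_hom parab_base) parab_test) <= 1.
Proof.
apply: cstar_norm_le => // xi fxi xi1.
have [cor [hc H]] := l2norm_lambda_extend parab_base parab_homD parab_hom_inj fxi.
rewrite expr1n -(@ger0_norm _ (l2norm _ ^+ 2)) ?sqr_ge0// -cnormR H.
apply: le_trans (parab_test_quadratic hc) _.
by rewrite exprn_ile1// l2norm_ge0.
Qed.

(** On the parabola [det X] is the remainder of [a^2] modulo [X^n], too short to be seen; in
    [ell_parab_shift] the translate adds [- X^(n+1)], which dominates. *)
Lemma ell_parab a : ell R (coset_pt parab_hom parab_base (a, parab a)) = n.+1%:R.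
Proof.
rewrite coset_ptE ell_coset /= rVpoly_parab; congr _%:R; apply/maxn_idPl.
rewrite {1}(divp_eq (rVpoly a ^+ 2) 'X^n) mulrC addrC addKr.
have := ltn_modp (rVpoly a ^+ 2) 'X^n; rewrite expf_neq0 ?polyX_eq0// size_polyXn => h.
exact: ltnW.
Qed.

Lemma ell_parab_shift a : ell R (coset_pt parab_hom parab_base (a, parab a + rV_X)) = n.+2%:R.
Proof.
rewrite coset_ptE ell_coset /= linearD /= rVpoly_parab rVpoly_rV_X; congr _%:R.
rewrite {1}(divp_eq (rVpoly a ^+ 2) 'X^n).
rewrite (_ : _ - _ = - 'X^(n.+1) + (rVpoly a ^+ 2) %% 'X^n); last by rewrite (exprS 'X n); ring.
have := ltn_modp (rVpoly a ^+ 2) 'X^n; rewrite expf_neq0 ?polyX_eq0// size_polyXn => h.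
by rewrite size_polyDl size_polyN size_polyXn ?(maxn_idPr _)// ltnW.
Qed.

(** The elements [uG 0 'X^m 0] represent the length [m + 1] for every [m > 0], so the differences
    for successive [n] telescope. *)
Lemma radial_sum (f : G -> C) : radial (@ell R F) f ->
  \sum_x f (coset_pt parab_hom parab_base x) * parab_test x =
  (norm_coef * q ^+ n.+1)%:C%C * (f (uG 0 'X^n 0) - f (uG 0 'X^(n.+1) 0)).
Proof.
move=> rf; have ez m : (0 < m)%N -> ell R (uG 0 ('X^m : {poly F}) 0) = m.+1%:R.
  move=> m0; rewrite /ell; case: eqP => [|_].
    by rewrite -uG0 => /uG_inj[_ /eqP]; rewrite expf_eq0 polyX_eq0 m0.
  rewrite /= (@hgt_siegel _ _ _ _ m.+1) ?size_polyXn ?size_poly0//.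
  by rewrite mulr0 subr0 expr0n /= size_poly0 maxn0.
transitivity (norm_coef%:C%C * \sum_(x : plane F n.+1) f (coset_pt parab_hom parab_base x) * parab_diff x).
  by rewrite mulr_sumr; apply: eq_bigr => x _; rewrite /parab_test mulrCA.
rewrite sum_parab_diff rmorphM /= -mulrA; congr (_ * _).
transitivity (\sum_(a : V) (f (uG 0 'X^n 0) - f (uG 0 'X^(n.+1) 0))).
  apply: eq_bigr => a _; congr (_ - _); apply: rf.
    by rewrite ell_parab ez.
  by rewrite ell_parab_shift ez.
by rewrite sumr_const card_mx mul1n -[LHS]mulr_natl -natrX rmorph_nat.
Qed.

Lemma norm_coef_sqrt : norm_coef * q ^+ n.+1 = Num.sqrt q ^+ n / 2.
Proof.
have q0 : 0 < q := lt_trans ltr01 q_gt1.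
have qs := sqr_sqrtr (ltW q0); set s := Num.sqrt q in qs *.
have s0 : s != 0 by rewrite gt_eqF// sqrtr_gt0.
have sE : Num.sqrt (q ^+ n.+2) = s ^+ n.+2.
  by rewrite -{1}qs exprAC sqrtr_sqr ger0_norm// exprn_ge0// sqrtr_ge0.
have qE : q ^+ n.+1 = s ^+ n.+2 * s ^+ n.
  by rewrite -{1}qs -exprM -exprD; congr (_ ^+ _); lia.
by rewrite /norm_coef sE qE; field; rewrite expf_neq0.
Qed.

Lemma cstar_step (f : G -> C) K : radial (@ell R F) f ->
  (forall psi, fin_supp psi -> cstar_norm psi <= 1 -> cstar_norm (pt_mul f psi) <= K) ->
  cnorm (f (uG 0 'X^n 0) - f (uG 0 'X^(n.+1) 0)) <= 2 * K * (Num.sqrt q)^-1 ^+ n.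
Proof.
move=> rf /(_ _ (extend_fin_supp (coset_pt parab_hom parab_base) parab_test) cstar_parab_test).
rewrite (pt_mul_extend _ parab_hom_inj) => hK.
have := le_trans (cstar_norm_sum parab_base parab_homD parab_hom_inj _) hK.
have q0 : 0 < q := lt_trans ltr01 q_gt1.
have s0 : 0 < Num.sqrt q ^+ n by rewrite exprn_gt0// sqrtr_gt0.
rewrite radial_sum// norm_coef_sqrt cnormM cnormR ger0_norm ?divr_ge0 ?(ltW s0)//.
by rewrite exprVn ler_pdivlMr//; move: (_ ^+ n) (cnorm _) => s z; lra.
Qed.

Lemma lp_step (f : G -> C) K r : 4 < r -> radial (@ell R F) f ->
  (forall psi, fin_supp psi -> lp_norm r psi <= 1 -> lp_norm r (pt_mul f psi) <= K) ->
  cnorm (f (uG 0 'X^n 0) - f (uG 0 'X^(n.+1) 0)) <=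
    2 * K * q `^ (2 / r) * (q `^ (2 / r) / Num.sqrt q) ^+ n.
Proof.
move=> r4 rf H; have r2 : 2 <= r by lra.
have := H _ (extend_fin_supp (coset_pt parab_hom parab_base) parab_test) (lp_norm_le1 parab_homD parab_hom_inj r2 cstar_parab_test).
rewrite (pt_mul_extend _ parab_hom_inj) => hK.
have q0 : 0 < q := lt_trans ltr01 q_gt1.
have s0 : 0 < Num.sqrt q ^+ n by rewrite exprn_gt0// sqrtr_gt0.
have cW : #|W|%:R `^ r^-1 = (q `^ (2 / r)) ^+ n.+1.
  rewrite card_prod card_mx mul1n -expnD natrX -powR_mulrn ?(ltW q0)// -powRrM.
  rewrite -powR_mulrn ?powR_ge0// -powRrM; congr (_ `^ _).
  by rewrite natrD; ring.
have := le_trans (lp_norm_ge parab_base parab_homD parab_hom_inj _ r2) (ler_wpM2l (powR_ge0 _ _) hK).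
rewrite radial_sum// norm_coef_sqrt cnormM cnormR ger0_norm ?divr_ge0 ?(ltW s0)// cW.
rewrite expr_div_n mulrA ler_pdivlMr// (exprS (q `^ (2 / r))).
set s := Num.sqrt q ^+ n; set t := (q `^ (2 / r)) ^+ n; set u := q `^ _; set z := cnorm _.
by clearbody s t u z; lra.
Qed.

End Paraboloid.

(** * Telescoping along a net and conclusion *)

Section Nets.
Variables (R : realType) (F : finFieldType).
Local Notation G := (Sp4 F).
Local Notation C := R[i].

(** Downward induction from [N] sums a geometric tail. The bound does not involve [N], hence is
    uniform over the net. *)
Lemma geometric_steps (z : nat -> C) (M r : R) (N : nat) : 0 <= r < 1 ->
  (forall n, (0 < n)%N -> cnorm (z n - z n.+1) <= M * r ^+ n) ->
  (forall n, (N <= n)%N -> z n = 0) ->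
  forall n, (0 < n)%N -> cnorm (z n) <= `|M| * r ^+ n / (1 - r).
Proof.
move=> /andP[r0 r1] hz hN n n0; have r1' : 0 < 1 - r by rewrite subr_gt0.
have : (N <= n + N)%N by rewrite leq_addl.
elim: {2}N n n0 => [|k IH] n n0 nk.
  rewrite addn0 in nk.
  by rewrite hN// cnorm0 divr_ge0 ?mulr_ge0 ?exprn_ge0// ltW.
rewrite -[z n](subrK (z n.+1)); apply: le_trans (ler_cnormD _ _) _.
have -> : `|M| * r ^+ n / (1 - r) = `|M| * r ^+ n + `|M| * r ^+ n.+1 / (1 - r).
  by rewrite exprS; field; rewrite gt_eqF.
apply: lerD; last by apply: IH => //; rewrite addSnnS.
by apply: le_trans (hz n n0) _; rewrite ler_wpM2r ?exprn_ge0// ler_norm.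
Qed.

Lemma fin_supp_siegel (f : G -> C) : fin_supp f ->
  exists N, forall n, (N <= n)%N -> f (uG 0 'X^n 0) = 0.
Proof.
move=> /fsuppP[X hX]; exists (\max_(g <- enum_fset X) size (val g i0 i3))%N => n Nn; apply: hX.
apply/negP => /(@leq_bigmax_seq _ _ xpredT (fun g : G => size (val g i0 i3))) /(_ isT) /=.
rewrite mxE /= size_polyXn => h; have := leq_trans h Nn.
by rewrite ltnn.
Qed.

Lemma no_net (I : Type) (le : I -> I -> Prop) (f : I -> G -> C) (M r : R) : 0 <= r < 1 ->
  directed le -> (forall a, fin_supp (f a)) -> net_to_one le f ->
  (forall a n, (0 < n)%N ->
     cnorm (f a (uG 0 'X^n 0) - f a (uG 0 'X^(n.+1) 0)) <= M * r ^+ n) -> False.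
Proof.
move=> r01 [[_ _] [lexx' _]] ff net step; case/andP: (r01) => r0 r1.
have r1' : 0 < 1 - r by rewrite subr_gt0.
have M1 : 0 < `|M| + 1 by rewrite ltr_wpDl.
(* Once [r^(n+1) < e], the geometric bound is below 1/2, while a member of the net close to 1 there
   has absolute value above 1/2. The added 1 covers [M = 0]. *)
pose e := (1 - r) / (2 * (`|M| + 1)).
have e0 : 0 < e by rewrite divr_gt0// mulr_gt0.
have : (fun n => r ^+ n) @ \oo --> (0 : R) by apply: cvg_expr; rewrite ger0_norm.
move=> /cvgrPdist_lt /(_ e e0) [n _ /(_ n.+1) hn].
have {}hn : r ^+ n.+1 < e.
  by have := hn (leqnSn n); rewrite sub0r normrN ger0_norm// exprn_ge0.
have [a ha] := net (uG 0 'X^(n.+1) 0) (1 / 2) ltac:(by rewrite divr_gt0).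
have {}ha := ha a (lexx' a).
have [N hN] := fin_supp_siegel (ff a).
have := geometric_steps r01 (step a) hN (ltn0Sn n).
apply/negP; rewrite -ltNge.
set z := f a _ in ha *.
have z1 : 1 <= cnorm (z - 1) + cnorm z.
  by have := ler_cnormD (1 - z) z; rewrite subrK cnorm1 -(cnormN (1 - z)) opprB.
apply: (@lt_le_trans _ _ (1 / 2)); last by lra.
rewrite ltr_pdivrMr//; apply: (@le_lt_trans _ _ ((`|M| + 1) * r ^+ n.+1)).
  by rewrite ler_wpM2r ?exprn_ge0// lerDl.
have -> : 1 / 2 * (1 - r) = (`|M| + 1) * e by rewrite /e; field; rewrite gt_eqF.
by rewrite ltr_pM2l.
Qed.

End Nets.

Theorem theorem1p4 (R : realType) (F : finFieldType) :
  odd #|F| ->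
  (exists S : seq (Sp4 F), generates S) /\
  exists l : Sp4 F -> R,
    length_function l /\
    (forall S : seq (Sp4 F), generates S -> bilipschitz_to_word l S) /\
    ~ (exists (I : Type) (le : I -> I -> Prop) (f : I -> Sp4 F -> R[i]),
         directed le /\
         (forall a, fin_supp (f a) /\ radial l (f a)) /\
         (exists K : R, forall a (phi : Sp4 F -> R[i]),
            fin_supp phi -> cstar_norm phi <= 1 -> cstar_norm (pt_mul (f a) phi) <= K) /\
         net_to_one le f) /\
    (forall p : R, 4 < p ->
      ~ (exists (I : Type) (le : I -> I -> Prop) (f : I -> Sp4 F -> R[i]),
           directed le /\
           (forall a, fin_supp (f a) /\ radial l (f a)) /\
           (exists K : R, forall a (phi : Sp4 F -> R[i]),
              fin_supp phi -> lp_norm p phi <= 1 -> lp_norm p (pt_mul (f a) phi) <= K) /\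
           net_to_one le f)).
Proof.
move=> oddF; have F2 : (2 : F) != 0.
  (* Translating the summation over [F] by 1 shows [#|F| = 0] in [F]; with [#|F|] odd and [2 = 0]
     this would give [1 = 0]. *)
  apply/negP => /eqP F2; have e : #|F|%:R = 0 :> F.
    apply: (addrI (\sum_(x : F) x)); rewrite addr0 [RHS](reindex_inj (addIr 1)).
    by rewrite big_split /= sumr_const.
  move/eqP: e; rewrite -[#|F|]odd_double_half oddF -muln2 natrD natrM F2 mulr0 addr0.
  by rewrite oner_eq0.
have q1 := q_gt1 R F; have q0 := lt_trans ltr01 q1.
have s0 : 0 < Num.sqrt (#|F|%:R : R) by rewrite sqrtr_gt0.
split; first exact: sp4_finitely_generated.
exists (@ell R F); split; first exact: ell_length.
split; first by move=> S; exact: ell_bilipschitz.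
split=> [|p p4] [I [le [f [dle [ff [[K hK] net]]]]]].
  apply: (@no_net _ _ I le f (2 * K) (Num.sqrt #|F|%:R)^-1) => //.
  - by rewrite invr_ge0 ltW//= invf_lt1// -[ltLHS]sqrtr1 ltr_sqrt.
  - by move=> a; case: (ff a).
  - by move=> a n n0; apply: cstar_step => //; [case: (ff a)|exact: hK].
apply: (@no_net _ _ I le f (2 * K * #|F|%:R `^ (2 / p)) (#|F|%:R `^ (2 / p) / Num.sqrt #|F|%:R)) => //.
(* The ratio is [q^(2/p - 1/2)], less than 1 precisely because [p > 4]. *)
- rewrite divr_ge0 ?powR_ge0 ?ltW//= ltr_pdivrMr// mul1r -powR12_sqrt ?(ltW q0)//.
  rewrite /powR gt_eqF// ltr_expR ltr_pM2r ?ln_gt0// -[2^-1]mul1r ltr_pdivrMr; last by lra.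
  by lra.
- by move=> a; case: (ff a).
- by move=> a n n0; apply: lp_step => //; [case: (ff a)|exact: hK].
Qed.
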